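(* Let $E = L + S$ be the mean field variational objective, viewed as a function of the mean parameter $m$ of the exponential-family variational distribution $q(\theta\mid\eta)$, where $L = \mathbb{E}_q[\log p(\theta\mid x)]$ and $S = -\mathbb{E}_q[\log q(\theta)]$. Let $m^*$ be an optimum of $E$ in the interior of the feasible space at which the Hessian $\frac{\partial^2 E}{\partial m\,\partial m^T}$ is invertible (strict local optimum). Let $m^*_t$ be the mean parameter of the variational approximation to the perturbed posterior $p_t(\theta\mid x)$, $\log p_t(\theta\mid x) = \log p(\theta\mid x) + t^T\theta - C(t)$, and define $$\hat\Sigma := \left.\frac{d m^*_t}{dt^T}\right|_{t=0}.$$ Then $$\hat\Sigma = -\left(\frac{\partial^2 E}{\partial m\,\partial m^T}\bigg|_{m=m^*}\right)^{-1} = -(H - V^{-1})^{-1} = (I - VH)^{-1}V,$$ where $V := \mathrm{Cov}_{q^*}(\theta)$ is the covariance matrix of $\theta$ under $q^*$ (the variational distribution with mean parameter $m^*$), $H := \frac{\partial^2 L}{\partial m\,\partial m^T}\big|_{m=m^*}$, and $I$ is the identity matrix. Moreover, $\hat\Sigma$ is symmetric and positive definite when $q^*$ is a local maximum of $E$.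
   Context: Here $p(\theta\mid x)$ is a fixed (posterior) density of a finite-dimensional vector $\theta$ of statistics, of arbitrary form, expressed with respect to a base measure on $\theta$. The variational family is an exponential family with respect to the same base measure, $\log q(\theta\mid\eta) = \eta^T\theta - A(\eta)$, with natural parameter $\eta$ and log partition function $A$ (in the mean field case, $q$ is a product over blocks of $\theta$, so it is a product of exponential families). The family is assumed regular and minimal, so that its covariance matrices are invertible and it can be parameterized by its mean $m := \mathbb{E}_q[\theta]$, ranging over an open set; expectations such as $\mathbb{E}_q[\log p(\theta\mid x)]$ are assumed finite. The entropy and log densities are taken with respect to the base measure. $p_t(\theta\mid x)$ is assumed to be a well-defined probability distribution for all $t$ in an open ball around $0$ ($C(t)$ is the normalizing constant). The variational objective for $p_t$ is, up to an additive constant in $m$, $E_t(m) = E(m) + t^Tm$. For $t$ near $0$, $m^*_t$ denotes the solution of the first-order condition $\frac{\partial E_t}{\partial m}(m^*_t) = 0$, depending differentiably on $t$, with $m^*_0 = m^*$; equivalently the fixed point $M_t(m_t^* ) = m_t^*$ of $M_t(m) := \frac{\partial E}{\partial m} + m + t$. For a vector-valued function $a(t)$, $\frac{d a}{dt^T}$ denotes the Jacobian matrix with entries $\partial a_i/\partial t_j$. *)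

(* Defs.v *)
From HB Require Import structures.
From mathcomp Require Import all_boot all_order all_algebra.
From mathcomp Require Import all_classical all_reals all_analysis.

Set Implicit Arguments.
Unset Strict Implicit.
Unset Printing Implicit Defensive.

Import Order.TTheory GRing.Theory Num.Theory.
Import numFieldNormedType.Exports.

Local Open Scope classical_set_scope.
Local Open Scope ring_scope.

(* Points theta of R^n are tuples, which carry the product (Borel)
   sigma-algebra; parameters eta, m, t are row vectors, which carry the normed
   structure used for derivatives. *)
Notation sample R n := (n.-tuple (measurableTypeR R)).

Section Density.
Context {R : realType} {n : nat}.
Variable mu : {measure set (sample R n) -> \bar R}.
Implicit Types (eta m t : 'rV[R]_n) (p : sample R n -> R).

Definition dot eta (x : sample R n) : R := \sum_(i < n) eta 0 i * tnth x i.

Definition is_density p : Prop :=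
  [/\ measurable_fun setT p, (forall x, 0 <= p x) &
      (\int[mu]_x (p x)%:E = 1)%E].

(* log p_t = log p + t^T theta - C(t) *)
Definition log_norm p t : R :=
  ln (fine (\int[mu]_x (p x * expR (dot t x))%:E)%E).

Definition perturb p t (x : sample R n) : R :=
  p x * expR (dot t x - log_norm p t).

(* The variational family is the full exponential family generated by [mu]. The
   mean field case is that of a product measure [mu]: the family is then the
   product of the exponential families generated by the factors. *)
Definition nat_space : set 'rV[R]_n :=
  [set eta | (\int[mu]_x (expR (dot eta x))%:E < +oo)%E].

Definition log_partition eta : R :=
  ln (fine (\int[mu]_x (expR (dot eta x))%:E)%E).

Definition qdens eta (x : sample R n) : R :=
  expR (dot eta x - log_partition eta).

Definition regular_family : Prop := open nat_space.

Definition minimal_family : Prop :=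
  forall (a : 'rV[R]_n) (b : R), a != 0 ->
    ~ {ae mu, forall x, dot a x = b}.

Definition expect eta (f : sample R n -> \bar R) : R :=
  fine (\int[mu]_x (f x * (qdens eta x)%:E))%E.

Definition mean eta : 'rV[R]_n := \row_i expect eta (fun x => (tnth x i)%:E).

Definition cov eta : 'M[R]_n :=
  \matrix_(i, j) expect eta
    (fun x => ((tnth x i - mean eta 0 i) * (tnth x j - mean eta 0 j))%:E).

Definition mean_space : set 'rV[R]_n := mean @` nat_space.

(* The natural parameter with mean [m]: it exists for [m] in [mean_space], and
   is unique when the family is minimal. *)
Definition nat_of_mean m : 'rV[R]_n :=
  xget 0 [set eta | nat_space eta /\ mean eta = m].

(* [lne 0 = -oo], so that integrability of the log density forces [p] to be
   positive almost everywhere. *)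
Definition log_integrable p : Prop :=
  forall eta, nat_space eta ->
    mu.-integrable setT (fun x => lne (p x)%:E * (qdens eta x)%:E)%E.

Definition exp_loglik p m : R :=
  expect (nat_of_mean m) (fun x => lne (p x)%:E).

Definition entropy m : R :=
  - expect (nat_of_mean m) (fun x => lne (qdens (nat_of_mean m) x)%:E).

Definition objective p m : R := exp_loglik p m + entropy m.

End Density.

Section Calculus.
Context {R : realType} {n : nat}.
Implicit Types (f : 'rV[R]_n -> R) (m : 'rV[R]_n).

Definition grad f m : 'rV[R]_n := \row_i 'D_(delta_mx 0 i) f m.

Definition hessian f m : 'M[R]_n :=
  \matrix_(i, j) 'D_(delta_mx 0 i) (fun y => 'D_(delta_mx 0 j) f y) m.

Definition local_max f m : Prop := \forall y \near m, f y <= f m.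

Definition local_min f m : Prop := \forall y \near m, f m <= f y.

Definition posdef (A : 'M[R]_n) : Prop :=
  forall u : 'rV[R]_n, u != 0 -> 0 < (u *m A *m u^T) 0 0.

End Calculus.

(* Main.v *)
Require Import Defs.
From HB Require Import structures.
From mathcomp Require Import all_boot all_order all_algebra.
From mathcomp Require Import all_classical all_reals all_analysis.
From mathcomp Require Import measurable_realfun ring lra.

Set Implicit Arguments.
Unset Strict Implicit.
Unset Printing Implicit Defensive.

Import Order.TTheory GRing.Theory Num.Theory.
Import numFieldNormedType.Exports.

Local Open Scope classical_set_scope.
Local Open Scope ring_scope.

(** Since every [f] that is integrable against the whole family satisfies a
    quadratic Taylor bound under the integral sign, moments are Frechet
    differentiable in [eta], and [mean] has Jacobian [cov], positive definite by
    minimality. Jensen's inequality makes [mean] monotone, so the local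
    coercivity given by [cov] propagates along rays to the whole parameter
    space; hence the inverse map is Lipschitz at interior points without any
    inverse function theorem, and is differentiable there with Jacobian
    [invmx cov]. Convex duality gives the entropy gradient [- eta], so the
    Hessian of the entropy is [- invmx cov]. Tilting by [t] shifts the gradient
    of the objective by [t]; the first-order condition is therefore
    [grad E (mt t) = - t], and differentiating it at [t = 0] gives the formula.
    Schwarz's theorem and the second-order necessary condition give symmetry
    and positive definiteness. *)

(** The obstacle is that [nat_of_mean] is a choice made by [xget], so no regularity of it is known
    in advance, not even continuity. Coercivity of [mean] near a fixed [eta] is not enough: the
    chosen parameter for a nearby mean could a priori lie far from [eta]. What is required is a
    lower bound on the displacement of the mean valid against every admissible parameter at once;
    then whatever parameter the choice returns lies within a constant times the displacement of the
    mean. One fixed base point suffices, since a derivative is a statement about one point. The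
    entropy gradient then uses only continuity of the inverse map: two supporting hyperplanes of the
    log partition function, one at each end of the displacement, squeeze the first-order
    remainder. *)

Section Inner.
Context {R : realType} {n : nat}.
Implicit Types (a b g h u v : 'rV[R]_n).

Definition inner a b : R := \sum_i a 0 i * b 0 i.

Lemma innerE a b : inner a b = (a *m b^T) 0 0.
Proof. by rewrite mxE; apply: eq_bigr => i _; rewrite !mxE. Qed.

Lemma innerC a b : inner a b = inner b a.
Proof. by apply: eq_bigr => i _; rewrite mulrC. Qed.

Lemma inner_is_linear a : linear (inner a).
Proof.
move=> k u v; rewrite /inner /= scaler_sumr -big_split.
by apply: eq_bigr => i _; rewrite !mxE mulrDr mulrCA.
Qed.

HB.instance Definition _ a :=
  GRing.isLinear.Build _ _ _ _ (inner a) (inner_is_linear a).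

Lemma innerDl a b u : inner (a + b) u = inner a u + inner b u.
Proof. by rewrite !(innerC _ u) linearD. Qed.

Lemma innerZl k a u : inner (k *: a) u = k * inner a u.
Proof. by rewrite !(innerC _ u) linearZ. Qed.

Lemma innerNl a u : inner (- a) u = - inner a u.
Proof. by rewrite !(innerC _ u) linearN. Qed.

Lemma innerBl a b u : inner (a - b) u = inner a u - inner b u.
Proof. by rewrite innerDl innerNl. Qed.

Lemma innerZr (k : R) a u : inner a (k *: u) = k * inner a u.
Proof. by rewrite linearZ. Qed.

Lemma innerNr a u : inner a (- u) = - inner a u.
Proof. by rewrite linearN. Qed.

Lemma innerBr a u v : inner a (u - v) = inner a u - inner a v.
Proof. by rewrite linearB. Qed.

Lemma inner_delta a i : inner a (delta_mx 0 i) = a 0 i.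
Proof.
rewrite /inner (bigD1 i) //= mxE !eqxx mulr1 big1 ?addr0 // => j ji.
by rewrite mxE (negbTE ji) andbF mulr0.
Qed.

Lemma norm_coord_le a i : `|a 0 i| <= `|a|.
Proof.
by rewrite [leRHS]/Num.Def.normr/= mx_normrE; exact: (le_bigmax _ _ (0, i)).
Qed.

Lemma norm_rV_le a (c : R) : 0 <= c -> (forall i, `|a 0 i| <= c) -> `|a| <= c.
Proof.
move=> c0 ac; rewrite [leLHS]/Num.Def.normr/= mx_normrE.
by apply: bigmax_le => //= -[i j] _ /=; rewrite (ord1 i).
Qed.

(** The norm on row vectors is the maximum of the coordinates, so Cauchy-Schwarz takes a dimension
    factor; the [n%:R] in later estimates comes from here. *)
Lemma normr_inner_le a b : `|inner a b| <= n%:R * `|a| * `|b|.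
Proof.
rewrite (le_trans (ler_norm_sum _ _ _))//.
have -> : n%:R * `|a| * `|b| = \sum_(i < n) `|a| * `|b|.
  by rewrite sumr_const card_ord -mulrA mulr_natl.
by apply: ler_sum => i _; rewrite normrM ler_pM// norm_coord_le.
Qed.

Lemma inner_sqr_ge a : `|a| ^+ 2 <= inner a a.
Proof.
have a0 : 0 <= inner a a by apply: sumr_ge0 => i _; rewrite -expr2 sqr_ge0.
rewrite -[leRHS]sqr_sqrtr// ler_sqr ?nnegrE ?sqrtr_ge0//.
apply: norm_rV_le (sqrtr_ge0 _) _ => i.
rewrite -sqrtr_sqr ler_wsqrtr// /inner (bigD1 i)//= -expr2 lerDl.
by apply: sumr_ge0 => j _; rewrite -expr2 sqr_ge0.
Qed.

Lemma inner_continuous a : continuous (inner a).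
Proof.
apply: bounded_linear_continuous; apply/linear_boundedP.
near=> M; move=> x; rewrite (le_trans (normr_inner_le a x))// ler_wpM2r//.
Unshelve. all: by end_near. Qed.

End Inner.

(** * Gradients of functions of a row vector *)

Section Gradient.
Context {R : realType} {n : nat}.
Implicit Types (f : 'rV[R]_n -> R) (x g h u v : 'rV[R]_n).

(** Little-o in epsilon form: a single estimate yields both differentiability and the value of the
    gradient, which is how integrals, inverse maps and the entropy are treated later. *)
Lemma has_grad f x g :
  (forall e, 0 < e ->
     \forall h \near (0 : 'rV[R]_n), `|f (h + x) - f x - inner g h| <= e * `|h|) ->
  differentiable f x /\ grad f x = g.
Proof.
move=> fg.
have dfE : 'd f x = inner g :> ('rV[R]_n -> R).
  apply: diff_unique; first exact: inner_continuous.
  apply/eqaddoP => e e0; have := fg e e0; apply: filterS => h /=.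
  by rewrite opprD addrA.
have df : differentiable f x.
  apply/diff_locallyP; rewrite dfE; split; first exact: inner_continuous.
  apply/eqaddoP => e e0; have := fg e e0; apply: filterS => h /=.
  by rewrite opprD addrA.
split=> //; apply/rowP => i; rewrite mxE deriveE// dfE; exact: inner_delta.
Qed.
Lemma derive_grad f x v : differentiable f x -> 'D_v f x = inner (grad f x) v.
Proof.
move=> df; rewrite deriveE// [in LHS](row_sum_delta v) linear_sum/=.
by apply: eq_bigr => i _; rewrite linearZ /= mxE deriveE// mulrC.
Qed.

Lemma grad_approx f x : differentiable f x ->
  forall e, 0 < e ->
    \forall h \near (0 : 'rV[R]_n), `|f (h + x) - f x - inner (grad f x) h| <= e * `|h|.
Proof.
move=> df e e0; have /eqaddoP/(_ e e0) := diff_locally df.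
apply: filterS => h /=.
by rewrite opprD addrA -derive_grad// deriveE.
Qed.

Lemma differentiable_rV m (N : 'rV[R]_n -> 'rV[R]_m) x :
  (forall j, differentiable (fun y => N y 0 j) x) -> differentiable N x.
Proof.
move=> dN.
have -> : N = \sum_(j < m) (fun y => N y 0 j *: delta_mx 0 j).
  by apply/funext => y; rewrite fct_sumE -row_sum_delta.
by apply: differentiable_sum => j; apply: differentiableZl.
Qed.

Lemma differentiable_coord_rV m (N : 'rV[R]_n -> 'rV[R]_m) x j :
  differentiable N x -> differentiable (fun y => N y 0 j) x.
Proof.
by move=> dN; exact: differentiable_comp dN (differentiable_coord _ _ _).
Qed.

Lemma derive_coord_rV m (N : 'rV[R]_n -> 'rV[R]_m) x v j :
  differentiable N x -> 'D_v (fun y => N y 0 j) x = ('D_v N x) 0 j.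
Proof.
by move=> dN; rewrite (derive_mx (diff_derivable (v := v) dN)) mxE.
Qed.

End Gradient.

Lemma derive_comp_rV {R : realType} {n m : nat} (f : 'rV[R]_m -> R)
    (N : 'rV[R]_n -> 'rV[R]_m) x v :
  differentiable N x -> differentiable f (N x) ->
  'D_v (f \o N) x = inner (grad f (N x)) ('D_v N x).
Proof.
move=> dN df; rewrite deriveE; last exact: differentiable_comp.
by rewrite diff_comp//= -derive_grad// deriveE// (deriveE v dN).
Qed.

Lemma near_ballP {R : realType} {n : nat} (P : 'rV[R]_n -> Prop) x :
  (\forall y \near x, P y) <-> exists2 r, 0 < r & forall h, `|h| < r -> P (h + x).
Proof.
split=> [/nbhs_normP[r r0 rP]|[r r0 rP]].
  by exists r => // h hr; apply: rP; rewrite /ball_/= opprD addrCA subrr addr0 normrN.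
apply/nbhs_normP; exists r => // y; rewrite /ball_/= distrC => /rP.
by rewrite subrK.
Qed.

(** * Second-order calculus *)

Section SecondOrder.
Context {R : realType} {n : nat}.
Implicit Types (f : 'rV[R]_n -> R) (x g h u v : 'rV[R]_n).

Lemma differentiable_shift f x w :
  differentiable f (x + w) -> differentiable (fun y => f (y + w)) x.
Proof.
move=> df; apply: (@differentiable_comp _ _ _ _ (fun y => y + w) f) => //.

Qed.

Lemma derive_shift_rV f x w v : 'D_v (fun y => f (y + w)) x = 'D_v f (x + w).
Proof.
rewrite /derive; set d := (fun _ : R => _); set d' := (fun _ : R => _).
by suff -> : d = d' by []; apply/funext => k; rewrite /d /d' /= addrA.
Qed.

Lemma is_derive_line f x u (s : R) : differentiable f (s *: u + x) ->
  is_derive s 1 (fun t : R => f (t *: u + x)) ('D_u f (s *: u + x)).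
Proof.
move=> df; have := diff_derivable (v := u) df.
rewrite /derivable => dfu; pose d (h : R) := h^-1 *: (f (h *: u + (s *: u + x)) - f (s *: u + x)).
have dE : (fun h : R => h^-1 *: (((fun t : R => f (t *: u + x)) \o shift s) (h *: 1)
    - f (s *: u + x))) = d.
  by apply/funext => k; rewrite /d /= scalerDl [k *: 1]mulr1 addrA.
split; first by rewrite /derivable dE.
by rewrite /derive dE.
Qed.

Lemma MVT_ray f x u (s : R) : 0 < s ->
  (forall t, 0 <= t <= s -> differentiable f (t *: u + x)) ->
  exists2 c, 0 < c < s & f (s *: u + x) - f x = s * 'D_u f (c *: u + x).
Proof.
move=> s0 df.
have [] := @MVT R (fun t => f (t *: u + x)) (fun t => 'D_u f (t *: u + x)) 0 s s0.
- move=> t; rewrite in_itv/= => /andP[t0 ts]; apply: is_derive_line.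
  by apply: df; rewrite !ltW.
- apply: derivable_within_continuous => t; rewrite in_itv/= => t0s.
  by have [] := is_derive_line (df _ t0s).
- move=> c; rewrite in_itv/= => cs; rewrite scale0r add0r subr0 => ->.
  by exists c; rewrite // mulrC.
Qed.

(** The second difference is the increment along [u] of [y] mapped to [f (y + s *: v) - f y]. The
    mean value theorem reduces it to two values of ['D_u f], each expanded to first order at [x];
    differentiability of ['D_u f] at that single point is enough. *)
Lemma second_difference f x u v :
  (\forall y \near x, differentiable f y) ->
  differentiable (fun y => 'D_u f y) x ->
  forall e, 0 < e -> exists2 d, 0 < d & forall s, 0 < s < d ->
    `|f (s *: u + s *: v + x) - f (s *: u + x) - f (s *: v + x) + f x
      - s ^+ 2 * 'D_v (fun y => 'D_u f y) x| <= e * s ^+ 2.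
Proof.
move=> /near_ballP[r r0 df] dP e e0.
(* All points visited, [c *: u] and [c *: u + s *: v] with [0 <= c <= s], have norm at most [s * M];
   the tolerance [e / (2 * M)] leaves each of the two expansions an error of [e * s / 2]. *)
pose M := `|u| + `|v| + 1.
have M0 : 0 < M by rewrite ltr_wpDl// addr_ge0.
have e'0 : 0 < e / (2 * M) by rewrite divr_gt0// mulr_gt0.
have := grad_approx dP e'0; move=> /near_ballP[r' r'0 Pr].
exists (Num.min r r' / M); first by rewrite divr_gt0// lt_min r0 r'0.
move=> s /andP[s0]; rewrite ltr_pdivlMr// lt_min => /andP[sr sr'].
have nu (c : R) : 0 <= c <= s -> `|c *: u| <= s * `|u|.
  by move=> /andP[c0 cs]; rewrite normrZ (ger0_norm c0) ler_wpM2r.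
have uM (c : R) : 0 <= c <= s -> `|c *: u| <= s * M.
  move=> cs; rewrite (le_trans (nu c cs))// ler_wpM2l ?(ltW s0)//.
  by rewrite /M -addrA lerDl addr_ge0.
have uvM (c : R) : 0 <= c <= s -> `|c *: u + s *: v| <= s * M.
  move=> cs; rewrite (le_trans (ler_normD _ _))//.
  have nv : `|s *: v| = s * `|v| by rewrite normrZ (gtr0_norm s0).
  rewrite nv (le_trans (lerD (nu c cs) (lexx _)))//.
  by rewrite -mulrDr ler_wpM2l ?(ltW s0)// /M lerDl.
have [|c /andP[c0 cs]] := @MVT_ray (fun y => f (y + s *: v) - f y) x u s s0.
  move=> t ts; apply: differentiableB.
    apply: differentiable_shift; rewrite addrAC; apply: df.
    exact: le_lt_trans (uvM _ ts) _.
  by apply: df; exact: le_lt_trans (uM _ ts) _.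
have cs' : 0 <= c <= s by rewrite !ltW.
have dfc : differentiable f (c *: u + x).
  by apply: df; exact: le_lt_trans (uM _ cs') _.
have dfcv : differentiable f (c *: u + x + s *: v).
  by rewrite addrAC; apply: df; exact: le_lt_trans (uvM _ cs') _.
rewrite deriveB; last 2 first.
  by apply: diff_derivable; exact: differentiable_shift.
  exact: diff_derivable.
rewrite derive_shift_rV [c *: u + x + _]addrAC [s *: u + x + _]addrAC.
have := Pr _ (le_lt_trans (uvM _ cs') sr').
have := Pr _ (le_lt_trans (uM _ cs') sr').
rewrite (derive_grad v dP) !addr0.
set p := grad _ _; rewrite linearD/= [inner p (s *: v)]linearZ/=.
set a := 'D_u f (c *: u + x); set b := 'D_u f (c *: u + s *: v + x).
set k := 'D_u f x.
set q := inner p v; set z := inner p _ => A B E.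
have eM : e / (2 * M) * (s * M) = e * s / 2.
  by field; rewrite gt_eqF.
have {}A : `|a - k - z| <= e * s / 2.
  by rewrite -eM (le_trans A)// ler_wpM2l ?(ltW e'0)// uM.
have {}B : `|b - k - (z + s * q)| <= e * s / 2.
  by rewrite -eM (le_trans B)// ler_wpM2l ?(ltW e'0)// uvM.
have -> : f (s *: u + s *: v + x) - f (s *: u + x) - f (s *: v + x) + f x
    = s * (b - a) by rewrite -E [s *: v + x]addrC; ring.
(* The term [z] depends on the unknown intermediate point [c], but occurs in both expansions and
   cancels. *)
have -> : s * (b - a) - s ^+ 2 * q
    = s * ((b - k - (z + s * q)) - (a - k - z)) by ring.
rewrite normrM (gtr0_norm s0) [leRHS](_ : _ = s * (e * s / 2 + e * s / 2)); last by field.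
rewrite ler_wpM2l ?(ltW s0)// (le_trans (ler_normB _ _))// lerD//.
Qed.

(** The second difference is symmetric in [u] and [v], so both mixed derivatives approximate the
    same number up to [e / 2 * s ^+ 2]. *)
Lemma derive_sym f x u v :
  (\forall y \near x, differentiable f y) ->
  differentiable (fun y => 'D_u f y) x ->
  differentiable (fun y => 'D_v f y) x ->
  'D_v (fun y => 'D_u f y) x = 'D_u (fun y => 'D_v f y) x.
Proof.
move=> df du dv; apply/eqP; rewrite -subr_eq0 -normr_eq0 eq_le normr_ge0 andbT.
apply/ler_addgt0Pl => e e0; rewrite addr0.
have e2 : 0 < e / 2 by rewrite divr_gt0.
have [d d0 D] := second_difference v df du e2.
have [d' d'0 D'] := second_difference u df dv e2.
pose s := Num.min d d' / 2.
have m0 : 0 < Num.min d d' by rewrite lt_min d0.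
have s0 : 0 < s by rewrite divr_gt0.
have sm : s < Num.min d d' by rewrite /s ltr_pdivrMr// ltr_pMr// ltr1n.
move: (sm); rewrite lt_min => /andP[sd sd'].
have := D s; have := D' s; rewrite s0 sd sd' => /(_ isT) + /(_ isT).
rewrite [s *: v + s *: u]addrC => A B.
have K (F a b c p q t : R) : `|F - a - b + c - q| <= t ->
    `|F - b - a + c - p| <= t -> `|p - q| <= t + t.
  move=> A' B'; have -> : p - q = (F - a - b + c - q) - (F - b - a + c - p) by ring.
  by rewrite (le_trans (ler_normB _ _))// lerD.
have := K _ _ _ _ _ _ _ A B.
rewrite -mulrBr normrM ger0_norm ?sqr_ge0// -mulrDl -splitr mulrC.
by rewrite ler_pM2r// exprn_gt0.
Qed.

Lemma hessian_sym f x :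
  (\forall y \near x, differentiable f y) ->
  (forall j, differentiable (fun y => 'D_(delta_mx 0 j) f y) x) ->
  (hessian f x)^T = hessian f x.
Proof. by move=> df dp; apply/matrixP => i j; rewrite !mxE derive_sym. Qed.

(** If the form were positive at [u], the derivative along [u], which vanishes at [x], would be
    positive at all small positive multiples of [u], and the mean value theorem would make [f]
    exceed [f x] there. *)
Lemma hessian_nsd f x u :
  (\forall y \near x, differentiable f y) ->
  (forall j, differentiable (fun y => 'D_(delta_mx 0 j) f y) x) ->
  grad f x = 0 -> local_max f x -> (u *m hessian f x *m u^T) 0 0 <= 0.
Proof.
move=> /near_ballP[r r0 df] dp g0 /near_ballP[r' r'0 mx].
(* The derivative along [u] written through partial derivatives, the form in which the hypotheses
   and the Hessian speak of it. *)
pose P y : R := \sum_j u 0 j * 'D_(delta_mx 0 j) f y.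
have PE y : differentiable f y -> 'D_u f y = P y.
  move=> dfy; rewrite derive_grad// innerC; apply: eq_bigr => j _.
  by rewrite mxE.
have dP : differentiable P x.
  have -> : P = \sum_j (fun y => u 0 j * 'D_(delta_mx 0 j) f y).
    by apply/funext => y; rewrite fct_sumE.
  by apply: differentiable_sum => j; apply: differentiableM.
have Px : P x = 0.
  have dfx : differentiable f x by rewrite -[x]add0r; apply: df; rewrite normr0.
  by rewrite -PE// derive_grad// g0 (innerC 0) linear0.
have -> : (u *m hessian f x *m u^T) 0 0 = inner (grad P x) u.
  rewrite -mulmxA mxE; apply: eq_bigr => i _; rewrite !mxE mulrC.
  congr (_ * _).
  have -> : P = \sum_j (fun y => u 0 j * 'D_(delta_mx 0 j) f y).
    by apply/funext => y; rewrite fct_sumE.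
  rewrite derive_sum; last first.
    by move=> j; apply: diff_derivable; apply: differentiableM.
  apply: eq_bigr => j _; rewrite [hessian f x i j]mxE [u^T j 0]mxE mulrC.
  by rewrite [RHS]deriveMl; last exact: diff_derivable.
set q := inner _ _; rewrite leNgt; apply/negP => q0.
have M0 : 0 < `|u| + 1 by rewrite ltr_wpDl.
(* With this tolerance the error at [c *: u] is at most [c * q / 2], half of the linear term
   [c * q]. *)
have e0 : 0 < q / (2 * (`|u| + 1)) by rewrite divr_gt0// mulr_gt0.
have /near_ballP[r2 r20 Pr] := grad_approx dP e0.
pose m := Num.min r (Num.min r' r2).
have m0 : 0 < m by rewrite !lt_min r0 r'0 r20.
pose s := m / (`|u| + 1).
have s0 : 0 < s by rewrite divr_gt0.
have su t : 0 <= t <= s -> `|t *: u| < m.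
  move=> /andP[t0 ts]; rewrite normrZ ger0_norm//.
  have -> : m = s * (`|u| + 1) by rewrite /s divfK// gt_eqF.
  by rewrite (le_lt_trans (ler_wpM2r _ ts))// ltr_pM2l// ltrDl.
have [t /su|c /andP[c0 cs] E] := @MVT_ray f x u s s0.
  by rewrite lt_min => /andP[tr _]; exact: df.
have fs : f (s *: u + x) - f x <= 0.
  rewrite subr_le0; apply: mx.
  by have := su s; rewrite lexx ltW// => /(_ isT); rewrite !lt_min => /and3P[].
have := su c; rewrite !ltW// => /(_ isT); rewrite !lt_min => /and3P[cr _ cr2].
move: fs; rewrite E PE; last exact: df.
rewrite pmulr_rle0// leNgt => /negP; apply.
have := Pr _ cr2; rewrite addr0 Px subr0 innerZr -/q normrZ (gtr0_norm c0).
rewrite ler_distlC => /andP[_]; rewrite -lerBlDr; apply: lt_le_trans.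
rewrite [_ - _](_ : _ = c * (q - q / (2 * (`|u| + 1)) * `|u|)); last by ring.
rewrite mulr_gt0// subr_gt0 mulrAC ltr_pdivrMr ?mulr_gt0// ltr_pM2l//.
have := normr_ge0 u; lra.
Qed.

End SecondOrder.

Lemma near_eq_differentiable {R : realType} {n : nat} (f g : 'rV[R]_n -> R) x :
  (\forall y \near x, f y = g y) -> differentiable f x -> differentiable g x.
Proof.
move=> /near_ballP[r r0 fg] df.
apply: proj1 (@has_grad R n g x (grad f x) _).
move=> e e0; have /near_ballP[r' r'0 A] := grad_approx df e0.
apply/near_ballP; exists (Num.min r r'); first by rewrite lt_min r0.
move=> h; rewrite lt_min => /andP[hr hr']; rewrite addr0 -fg//.
have <- : f x = g x by rewrite -[x]add0r fg ?normr0.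
by have := A h hr'; rewrite addr0.
Qed.

(** * Differentiating determinants, inverse matrices and inverse maps *)

Section MatrixCalculus.
Context {R : realType} {n : nat}.
Implicit Types (x : 'rV[R]_n).

Lemma differentiable_prod (I : Type) (r : seq I) (F : I -> 'rV[R]_n -> R) x :
  (forall i, differentiable (F i) x) ->
  differentiable (fun y => \prod_(i <- r) F i y) x.
Proof.
move=> dF; elim: r => [|i r ih].
  by under eq_fun do rewrite big_nil; exact: differentiable_cst.
under eq_fun do rewrite big_cons.
exact: differentiableM.
Qed.

Lemma differentiable_bigsum (I : Type) (r : seq I) (F : I -> 'rV[R]_n -> R) x :
  (forall i, differentiable (F i) x) ->
  differentiable (fun y => \sum_(i <- r) F i y) x.
Proof.
move=> dF; elim: r => [|i r ih].
  by under eq_fun do rewrite big_nil; exact: differentiable_cst.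
under eq_fun do rewrite big_cons.
exact: differentiableD.
Qed.

Lemma differentiable_det m (A : 'rV[R]_n -> 'M[R]_m) x :
  (forall i j, differentiable (fun y => A y i j) x) ->
  differentiable (fun y => \det (A y)) x.
Proof.
move=> dA; apply: differentiable_bigsum => s.
apply: differentiableM; first exact: differentiable_cst.
exact: differentiable_prod.
Qed.

(** Cramer's rule: near [x] each entry of the inverse is a cofactor divided by the determinant. *)
Lemma differentiable_invmx m (A : 'rV[R]_n -> 'M[R]_m) x i j :
  (\forall y \near x, A y \in unitmx) ->
  (forall i j, differentiable (fun y => A y i j) x) ->
  differentiable (fun y => invmx (A y) i j) x.
Proof.
move=> uA dA.
apply: (@near_eq_differentiable _ _
  (fun y => (\det (A y))^-1 * ((-1) ^+ (j + i) * \det (row' j (col' i (A y)))))).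
  by apply: filterS uA => y uA; rewrite /invmx uA !mxE.
apply: differentiableM.
  apply: differentiableV; first exact: differentiable_det.
  by have := nbhs_singleton uA; rewrite unitmxE unitfE.
apply: differentiableM; first exact: differentiable_cst.
apply: differentiable_det => k l.
by under eq_fun do rewrite !mxE; exact: dA.
Qed.

(** Expanding [M] at [N m] makes [k] equal to [h *m V] plus a remainder small relative to the
    displacement [h] of [N]; the Lipschitz bound makes it small relative to [k], and [h] is
    recovered by multiplying with the inverse of [V]. Row vectors act from the left, so [V] is the
    transpose of the usual Jacobian. *)
Lemma differentiable_right_inverse (M N : 'rV[R]_n -> 'rV[R]_n) m (C : R) :
  let V := \matrix_(i, j) 'D_(delta_mx 0 i) (fun y => M y 0 j) (N m) in
  (forall j, differentiable (fun y => M y 0 j) (N m)) ->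
  V \in unitmx ->
  (\forall y \near m, M (N y) = y) ->
  (\forall y \near m, `|N y - N m| <= C * `|y - m|) ->
  forall j, differentiable (fun y => N y 0 j) m /\
    grad (fun y => N y 0 j) m = \row_i invmx V i j.
Proof.
move=> V dM uV /near_ballP[r r0 MN] /near_ballP[r' r'0 NC] j.
apply: has_grad => e e0; set W := invmx V.
(* [K] dominates column [j] of [W], and [D] is a positive bound for [C], whose sign is not
   prescribed; the tolerance [e / (D * K)] then ends as [e]. *)
pose K := \sum_i `|W i j| + 1.
have K0 : 0 < K by rewrite ltr_wpDl// sumr_ge0.
pose D := `|C| + 1.
have D0 : 0 < D by rewrite ltr_wpDl.
have e'0 : 0 < e / (D * K) by rewrite divr_gt0// mulr_gt0.
have A0 i : \forall h \near (0 : 'rV[R]_n),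
    `|M (h + N m) 0 i - M (N m) 0 i - inner (grad (fun y => M y 0 i) (N m)) h|
      <= e / (D * K) * `|h|.
  exact: (grad_approx (dM i) e'0).
have : \forall h \near (0 : 'rV[R]_n), forall i : 'I_n,
    `|M (h + N m) 0 i - M (N m) 0 i - inner (grad (fun y => M y 0 i) (N m)) h|
      <= e / (D * K) * `|h|.
  exact: (filter_forall _ A0).
move=> /near_ballP[s s0 A].
apply/near_ballP; exists (Num.min r (Num.min r' (s / D))).
  by rewrite !lt_min r0 r'0 divr_gt0.
move=> k; rewrite addr0 !lt_min ltr_pdivlMr// => /and3P[kr kr' ks].
set h := N (k + m) - N m.
have hk : `|h| <= D * `|k|.
  rewrite (le_trans (NC _ kr'))// addrK ler_wpM2r// /D.
  by rewrite (le_trans (ler_norm _))// lerDl.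
have hs : `|h| < s by rewrite (le_lt_trans hk)// mulrC.
(* Since [M (N (k + m)) - M (N m)] is [k], this is the first-order remainder of [M] at [N m]. *)
pose d := k - h *m V.
have dE i : `|d 0 i| <= e / (D * K) * `|h|.
  have := A h hs i; rewrite addr0 subrK MN//.
  have -> : M (N m) = m by rewrite -[in LHS](add0r m) MN ?normr0// add0r.
  congr (`|_| <= _); rewrite !mxE addrK; congr (_ - _).
  by apply: eq_bigr => l _; rewrite !mxE mulrC.
have -> : N (k + m) 0 j - N m 0 j - inner (\row_i W i j) k = - (d *m W) 0 j.
  have -> : d *m W = k *m W - h by rewrite mulmxBl -mulmxA mulmxV// mulmx1.
  rewrite /h !mxE opprB; congr (_ - _).
  by apply: eq_bigr => l _; rewrite !mxE mulrC.
rewrite normrN mxE (le_trans (ler_norm_sum _ _ _))//.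
apply: (@le_trans _ _ (\sum_i e / (D * K) * (D * `|k|) * `|W i j|)).
  apply: ler_sum => i _; rewrite normrM ler_wpM2r// (le_trans (dE i))//.
  by rewrite ler_wpM2l// ltW.
rewrite -mulr_sumr [leRHS](_ : _ = e / (D * K) * (D * `|k|) * K); last first.
  by field; rewrite !gt_eqF.
have c0 : 0 <= e / (D * K) * (D * `|k|).
  rewrite (mulr_ge0 (ltW e'0))//; exact: (mulr_ge0 (ltW D0)).
by apply: ler_wpM2l => //; rewrite /K lerDl.
Qed.

End MatrixCalculus.

(** * Positive definite matrices *)

Section QuadraticForms.
Context {R : realType} {n : nat}.
Implicit Types (A V : 'M[R]_n) (u v w h : 'rV[R]_n).

Lemma inner_mulmx u A v : inner (u *m A) v = inner u (v *m A^T).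
Proof. by rewrite !innerE trmx_mul trmxK mulmxA. Qed.

Lemma normr_quadratic_le A : exists2 C, 0 < C & forall h, `|inner (h *m A) h| <= C * `|h| ^+ 2.
Proof.
pose K := \sum_i \sum_j `|A i j| + 1.
have S0 : 0 <= \sum_i \sum_j `|A i j| by do 2!apply: sumr_ge0 => ? _.
exists (n%:R * K + 1); first by rewrite ltr_wpDl// mulr_ge0// addr_ge0.
move=> h; rewrite (le_trans (normr_inner_le _ _))// expr2 mulrA ler_wpM2r//.
rewrite mulrDl -!mulrA mul1r (@le_trans _ _ (n%:R * (K * `|h|)))//; last by rewrite lerDl.
rewrite ler_wpM2l//; apply: norm_rV_le => [|j]; first by rewrite mulr_ge0// addr_ge0.
rewrite mxE (le_trans (ler_norm_sum _ _ _))//.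
apply: (@le_trans _ _ (\sum_i `|h| * `|A i j|)).
  by apply: ler_sum => i _; rewrite normrM ler_wpM2r// norm_coord_le.
rewrite -mulr_sumr mulrC ler_wpM2r// /K exchange_big/= [X in _ <= X + 1](bigD1 j)//= -addrA lerDl.
by rewrite addr_ge0//; do 2!apply: sumr_ge0 => ? _.
Qed.

Lemma posdef_unitmx V : posdef V -> V \in unitmx.
Proof.
move=> pV; rewrite -row_free_unit; apply: inj_row_free => u uV0.
apply/eqP; rewrite -[_ == _]negbK; apply/negP => /pV.
by rewrite uV0 mul0mx mxE ltxx.
Qed.

(* Minimizing the quadratic form along the direction [h V^-1]. *)
Lemma posdef_coercive V : V^T = V -> posdef V ->
  exists2 c, 0 < c & forall h, c * `|h| ^+ 2 <= inner (h *m V) h.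
Proof.
move=> sV pV; have uV := posdef_unitmx pV.
have psd u : 0 <= inner (u *m V) u.
  have [->|/pV] := eqVneq u 0; first by rewrite linear0.
  by rewrite innerE => /ltW.
have [C C0 HC] := normr_quadratic_le (invmx V).
exists C^-1; first by rewrite invr_gt0.
move=> h; pose w := h *m invmx V.
have wV : w *m V = h by rewrite mulmxKV.
have hVw : inner (h *m V) w = inner h h by rewrite inner_mulmx sV wV.
(* The expansion is [inner (h *m V) h - 2 * C^-1 * inner h h + C^-1 ^+ 2 * inner h w]. Its last term
   is at most [C^-1 * |h| ^+ 2] by the choice of [C], and [inner h h] is at least [|h| ^+ 2]. *)
have := psd (h - C^-1 *: w); rewrite mulmxBl -scalemxAl wV.
rewrite innerBl innerZl !linearB/= ![inner _ (C^-1 *: w)]linearZ/= hVw.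
have := HC h; rewrite -/w innerC => /(le_trans (ler_norm _)) hw.
rewrite -[in inner h w]wV.
rewrite [inner (w *m V) w]inner_mulmx sV wV innerC.
rewrite /GRing.scale/= => B; have := inner_sqr_ge h => I.
have CC : C^-1 * (C^-1 * inner h w) <= C^-1 * `|h| ^+ 2.
  by rewrite ler_wpM2l ?invr_ge0 ?(ltW C0)// ler_pdivrMl.
have : C^-1 * `|h| ^+ 2 <= C^-1 * inner h h by rewrite ler_wpM2l ?invr_ge0 ?(ltW C0).
rewrite mulrBr [inner w h]innerC in B; lra.
Qed.

(** A null vector [u] of a semidefinite form lies in the kernel of [A]: otherwise moving from [u]
    against [u *m A] would make the form negative. *)
Lemma psd_unit_posdef A : A^T = A -> A \in unitmx ->
  (forall u, 0 <= inner (u *m A) u) -> posdef A.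
Proof.
move=> sA uA psd u u0; rewrite -innerE lt_neqAle psd andbT eq_sym.
apply: contra u0 => /eqP uAu; pose w := u *m A.
suff w0 : w = 0 by rewrite -[u](mulmxK uA) -/w w0 mul0mx.
have q0 := psd w; set q := inner (w *m A) w in q0.
pose p := inner w w; have Ip := inner_sqr_ge w; rewrite -/p in Ip.
(* The form here is [- 2 * l * p + l ^+ 2 * q] with [l = p / (q + 1)], that is
   [- p ^+ 2 * (q + 2) / (q + 1) ^+ 2]. The [+ 1] covers [q = 0]. *)
have := psd (u - (p / (q + 1)) *: w); rewrite mulmxBl -scalemxAl.
rewrite innerBl innerZl !linearB/= ![inner _ (_ *: w)]linearZ/= uAu -/q -/w -/p.
rewrite (_ : inner (w *m A) u = p); last by rewrite inner_mulmx sA.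
rewrite /GRing.scale/= => B.
have q1 : 0 < q + 1 by rewrite ltr_wpDl.
have : 0 <= - (p ^+ 2 * (q + 2)) / (q + 1) ^+ 2.
  rewrite [leRHS](_ : _ = 0 - p / (q + 1) * p -
    p / (q + 1) * (p - p / (q + 1) * q))//; field; exact: lt0r_neq0.
rewrite mulNr oppr_ge0 pmulr_lle0 ?invr_gt0 ?exprn_gt0//.
rewrite pmulr_lle0; last by rewrite ltr_wpDl.
move=> p2; have p0 : p = 0.
  by apply/eqP; rewrite -sqrf_eq0 eq_le p2 sqr_ge0.
move: Ip; rewrite p0 => w2; apply/eqP; rewrite -normr_eq0 -sqrf_eq0.
by rewrite eq_le w2 sqr_ge0.
Qed.

Lemma posdef_invmx A : A^T = A -> posdef A -> posdef (invmx A).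
Proof.
move=> sA pA u u0; have uA := posdef_unitmx pA.
have := pA (u *m invmx A); rewrite mulmxKV// trmx_mul trmx_inv sA mulmxA; apply.
by apply: contra u0 => /eqP uA0; rewrite -[u](mulmxKV uA) uA0 mul0mx.
Qed.

End QuadraticForms.

(** * Exponential tilting *)

(** Only [1 + y <= expR y] is used, at [y] and at [- y]; the second gives
    [expR y - 1 <= y * expR y]. *)
Lemma expR_sub1_le {R : realType} (y : R) :
  `|expR y - 1 - y| <= y ^+ 2 * expR `|y|.
Proof.
have lo := expR_ge1Dx y; rewrite ger0_norm; last by lra.
have hi : expR y - 1 <= y * expR y.
  have := expR_ge1Dx (- y); rewrite expRN => h.
  have := ler_wpM2r (expR_ge0 y) h.
  by rewrite mulVf ?gt_eqF ?expR_gt0//; lra.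
have [y0|y0] := ger0P y.
  have : y * (expR y - 1) <= y * (y * expR y) by rewrite ler_wpM2l.
  rewrite expr2 -mulrA; lra.
have e1 : 1 <= expR (- y) by rewrite -expR0 ler_expR oppr_ge0 ltW.
have : y * (expR y - 1) <= y * y by rewrite ler_nM2l//; lra.
have : y ^+ 2 * 1 <= y ^+ 2 * expR (- y) by rewrite ler_wpM2l ?sqr_ge0.
rewrite expr2; lra.
Qed.

Section Tilt.
Context {R : realType} {n : nat}.
Variable mu : {measure set (sample R n) -> \bar R}.
Implicit Types (eta h u v : 'rV[R]_n) (f g : sample R n -> R) (x : sample R n).

Definition row_of_sample x : 'rV[R]_n := \row_i tnth x i.

Lemma dotE eta x : dot eta x = inner eta (row_of_sample x).
Proof. by apply: eq_bigr => i _; rewrite mxE. Qed.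

Lemma dotD eta h x : dot (eta + h) x = dot eta x + dot h x.
Proof. by rewrite !dotE innerDl. Qed.

Lemma dotZ (k : R) h x : dot (k *: h) x = k * dot h x.
Proof. by rewrite !dotE innerZl. Qed.

Lemma dot_delta i x : dot (delta_mx 0 i) x = tnth x i.
Proof. by rewrite dotE innerC inner_delta mxE. Qed.

Lemma measurable_dot eta : measurable_fun setT (dot eta).
Proof.
apply: measurable_sum => i; apply: measurable_funM => //.
exact: measurable_tnth.
Qed.

Definition tilt f eta x : R := f x * expR (dot eta x).

(** The class of integrands on which differentiation in [eta] can be iterated: when the natural
    parameter space is open it is stable under multiplication by coordinates. *)
Definition tiltable f : Prop :=
  measurable_fun setT f /\
  forall eta, nat_space mu eta -> mu.-integrable setT (EFin \o tilt f eta).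

Definition expmom f eta : R := \int[mu]_x tilt f eta x.

Lemma measurable_tilt f eta : measurable_fun setT f ->
  measurable_fun setT (tilt f eta).
Proof.
move=> mf; apply: measurable_funM => //.
by apply: measurableT_comp => //; exact: measurable_dot.
Qed.

Lemma integrableR_dominated f g : measurable_fun setT f ->
  (forall x, `|f x| <= g x) -> mu.-integrable setT (EFin \o g) ->
  mu.-integrable setT (EFin \o f).
Proof.
move=> mf fg ig; apply: le_integrable ig => //; first exact/measurable_EFinP.
by move=> x _ /=; rewrite lee_fin (le_trans (fg x))// ler_norm.
Qed.

Lemma tiltable1 : tiltable (cst 1).
Proof.
split=> // eta heta; apply/integrableP; split.
  by apply/measurable_EFinP; apply: measurable_tilt; exact: measurable_cst.
apply: le_lt_trans heta; rewrite le_eqVlt; apply/orP; left; apply/eqP.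
by apply: eq_integral => x _; rewrite /= /tilt mul1r ger0_norm ?expR_ge0.
Qed.

Lemma tiltableD f g : tiltable f -> tiltable g -> tiltable (fun x => f x + g x).
Proof.
move=> [mf hf] [mg hg]; split; first exact: measurable_funD.
move=> eta heta; have := integrableD measurableT (hf _ heta) (hg _ heta).
apply: eq_integrable => // x _ /=; by rewrite -EFinD -mulrDl.
Qed.

Lemma tiltableZ (k : R) f : tiltable f -> tiltable (fun x => k * f x).
Proof.
move=> [mf hf]; split; first exact: measurable_funM.
move=> eta heta; have := integrableZl measurableT k (hf _ heta).
apply: eq_integrable => // x _ /=; by rewrite -EFinM /tilt mulrA.
Qed.

Lemma tiltable_sum (I : Type) (r : seq I) (F : I -> sample R n -> R) :
  (forall i, tiltable (F i)) -> tiltable (fun x => \sum_(i <- r) F i x).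
Proof.
move=> tF; elim: r => [|i r ih].
  have := tiltableZ 0 tiltable1.
  by congr tiltable; apply/funext => x; rewrite big_nil mul0r.
under eq_fun do rewrite big_cons; exact: tiltableD.
Qed.

Lemma expmomD f g eta : tiltable f -> tiltable g -> nat_space mu eta ->
  expmom (fun x => f x + g x) eta = expmom f eta + expmom g eta.
Proof.
move=> [_ hf] [_ hg] heta.
rewrite /expmom -(RintegralD measurableT (hf _ heta) (hg _ heta)).
by apply: eq_Rintegral => x _; rewrite /tilt mulrDl.
Qed.

Lemma expmomZ (k : R) f eta : tiltable f -> nat_space mu eta ->
  expmom (fun x => k * f x) eta = k * expmom f eta.
Proof.
move=> [_ hf] heta; rewrite /expmom -(RintegralZl k measurableT (hf _ heta)).
by apply: eq_Rintegral => x _; rewrite /tilt mulrA.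
Qed.

Lemma expmom_sum (I : Type) (r : seq I) (F : I -> sample R n -> R) eta :
  (forall i, tiltable (F i)) -> nat_space mu eta ->
  expmom (fun x => \sum_(i <- r) F i x) eta = \sum_(i <- r) expmom (F i) eta.
Proof.
move=> tF heta; elim: r => [|i r ih].
  rewrite big_nil -[RHS](mul0r (expmom (cst 1) eta)) -expmomZ//; last exact: tiltable1.
  by congr expmom; apply/funext => x; rewrite big_nil mul0r.
rewrite big_cons -ih -expmomD//; last exact: tiltable_sum.
by congr expmom; apply/funext => x; rewrite big_cons.
Qed.

(* A finite sum of exponentials of linear forms, hence tiltable, that dominates
   the exponential of a multiple of the norm. *)
Definition exp_envelope (r : R) x : R :=
  1 + \sum_i (expR (dot ((n%:R * r) *: delta_mx 0 i) x)
            + expR (dot (- (n%:R * r) *: delta_mx 0 i) x)).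

Lemma exp_envelope_ge (r : R) x : expR (n%:R * r * `|row_of_sample x|) <= exp_envelope r x.
Proof.
rewrite /exp_envelope.
have S0 (i : 'I_n) : 0 <= expR (dot ((n%:R * r) *: delta_mx 0 i) x)
            + expR (dot (- (n%:R * r) *: delta_mx 0 i) x).
  by rewrite addr_ge0 ?expR_ge0.
(* The leading [1] of the envelope serves this case, which includes [n = 0], where no coordinate
   attains the norm. *)
have [->|x0] := eqVneq (row_of_sample x) 0.
  by rewrite normr0 mulr0 expR0 lerDl sumr_ge0.
have [[j i]] := mx_norm_neq0 (contra_neq (@mx_norm_eq0 _ _ _ _) x0).
rewrite -[mx_norm _]/(`|row_of_sample x|) /= (ord1 j) => ->.
rewrite (bigD1 i)//= [_ + (_ + _)]addrC -addrA ler_wpDr//.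
  by rewrite addr_ge0// sumr_ge0.
rewrite mxE !dotZ dot_delta.
have [t0|t0] := ger0P (tnth x i).
  by rewrite lerDl expR_ge0.
by rewrite mulrN mulNr lerDr expR_ge0.
Qed.

(** Openness leaves room around [eta]: each exponential in the envelope shifts the parameter to
    another point of the natural space, where [f] is still integrable. *)
Lemma tiltable_envelope f eta : open (nat_space mu) -> tiltable f ->
  nat_space mu eta -> exists2 r, 0 < r &
  (forall h, `|h| <= r -> nat_space mu (eta + h)) /\
  mu.-integrable setT (EFin \o (fun x => `|tilt f eta x| * exp_envelope r x)).
Proof.
move=> onat [mf hf] heta.
have /near_ballP[d d0 hd] := open_nbhs_nbhs (conj onat heta).
(* Both [r] and [n%:R * r] must stay below [d], the first for the shifts [h], the second for the
   parameters in the envelope. *)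
pose r := d / (2 * (n%:R + 1)).
have n1 : 0 < n%:R + 1 :> R by rewrite ltr_wpDl.
have r0 : 0 < r by rewrite divr_gt0// mulr_gt0.
have dr : d = 2 * (n%:R + 1) * r by rewrite /r mulrC divfK// gt_eqF// mulr_gt0.
have nr : n%:R * r < d.
  have := mulr_ge0 (ler0n R n) (ltW r0); rewrite dr; lra.
have rd : r < d.
  have := mulr_ge0 (ler0n R n) (ltW r0); rewrite dr; lra.
move: r r0 nr rd {dr} => r r0 nr rd.
have nr0 : 0 <= n%:R * r by rewrite mulr_ge0// ltW.
exists r => //; split=> [h hr|].
  by rewrite addrC; apply: hd; exact: le_lt_trans hr rd.
have dl i (s : R) : `|s| = n%:R * r -> nat_space mu (eta + s *: delta_mx 0 i).
  move=> sE; rewrite addrC; apply: hd; rewrite normrZ sE.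
  apply: le_lt_trans nr; rewrite ler_piMr//.
  apply: norm_rV_le => // j; rewrite mxE eqxx/=.
  by case: (j == i); rewrite ?normr1 ?normr0.
have iT u : nat_space mu (eta + u) ->
    mu.-integrable setT (EFin \o (fun x => `|tilt f eta x| * expR (dot u x))).
  move=> /hf/integrable_norm; apply: eq_integrable => // x _ /=; congr EFin.
  by rewrite /tilt dotD expRD !normrM !(ger0_norm (expR_ge0 _)) mulrA.
have i0 : mu.-integrable setT (EFin \o (fun x => `|tilt f eta x| * 1)).
  by under eq_fun do rewrite mulr1; apply: integrable_norm; exact: hf.
have iS : mu.-integrable setT (fun x => (\sum_(i < n)
    (`|tilt f eta x| * expR (dot ((n%:R * r) *: delta_mx 0 i) x)
     + `|tilt f eta x| * expR (dot (- (n%:R * r) *: delta_mx 0 i) x))%:E)%E).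
  have p1 : `|n%:R * r| = n%:R * r by rewrite ger0_norm.
  have p2 : `|- (n%:R * r)| = n%:R * r by rewrite normrN ger0_norm.
  apply: integrable_sum => // i _.
  exact: (integrableD measurableT (iT _ (dl i _ p1)) (iT _ (dl i _ p2))).
have := integrableD measurableT i0 iS; apply: eq_integrable => // x _ /=.
rewrite sumEFin -EFinD /exp_envelope mulrDr mulr_sumr; congr (_ + _)%:E.
by apply: eq_bigr => i _; rewrite mulrDr.
Qed.

End Tilt.

(** * Differentiation under the integral sign *)

Section ExpFamilyCalculus.
Context {R : realType} {n : nat}.
Variable mu : {measure set (sample R n) -> \bar R}.
Hypothesis onat : open (nat_space mu).
Implicit Types (eta h u v : 'rV[R]_n) (f g : sample R n -> R) (x : sample R n).

(** A coordinate grows more slowly than the exponential of a multiple of the norm, so the envelope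
    absorbs it. *)
Lemma tiltable_coord f i : tiltable mu f -> tiltable mu (fun x => tnth x i * f x).
Proof.
move=> tf; have [mf _] := tf.
have m' : measurable_fun setT (fun x : sample R n => tnth x i * f x).
  by apply: measurable_funM => //; exact: measurable_tnth.
split=> // eta heta; have [r r0 [_ ie]] := tiltable_envelope onat tf heta.
have nr0 : 0 < n%:R * r.
  by rewrite mulr_gt0// ltr0n (leq_ltn_trans _ (ltn_ord i)).
have := integrableZl measurableT (n%:R * r)^-1 ie; apply: integrableR_dominated.
  exact: measurable_tilt.
move=> x /=; rewrite /tilt -mulrA normrM mulrC mulrCA ler_wpM2l//.
rewrite ler_pdivlMl// (le_trans _ (exp_envelope_ge r x))//.
apply: (@le_trans _ _ (n%:R * r * `|row_of_sample x|)).
  rewrite ler_wpM2l ?(ltW nr0)// -[tnth x i](_ : row_of_sample x 0 i = _).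
    exact: norm_coord_le.
  by rewrite mxE.
by have := expR_ge1Dx (n%:R * r * `|row_of_sample x|); lra.
Qed.

Lemma tiltable_dot f h : tiltable mu f -> tiltable mu (fun x => dot h x * f x).
Proof.
move=> tf; rewrite (_ : (fun _ => _) =
    fun x => \sum_i h 0 i * (tnth x i * f x)).
  by apply: tiltable_sum => i; apply: tiltableZ; exact: tiltable_coord.
by apply/funext => x; rewrite mulr_suml; apply: eq_bigr => i _; rewrite mulrA.
Qed.

Lemma expmom_dot f h eta : tiltable mu f -> nat_space mu eta ->
  expmom mu (fun x => dot h x * f x) eta =
  inner (\row_i expmom mu (fun x => tnth x i * f x) eta) h.
Proof.
move=> tf heta; rewrite (_ : (fun _ => _) =
    fun x => \sum_i h 0 i * (tnth x i * f x)); last first.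
  by apply/funext => x; rewrite mulr_suml; apply: eq_bigr => i _; rewrite mulrA.
rewrite expmom_sum//; last first.
  by move=> i; apply: tiltableZ; exact: tiltable_coord.
apply: eq_bigr => i _; rewrite expmomZ ?mxE 1?mulrC//.
exact: tiltable_coord.
Qed.

(** With [s = n * |x|] the envelope dominates [expR (r * s)]. Half of this exponent controls
    [expR |dot h x|]; the other half absorbs [s ^+ 2], where [y ^+ 2 / 2 <= expR y] at
    [y = r / 2 * s] produces the [8]. *)
Lemma exp_remainder_le (r : R) h x : 0 < r -> `|h| <= r / 2 ->
  `|expR (dot h x) - 1 - dot h x| <= 8 / r ^+ 2 * `|h| ^+ 2 * exp_envelope r x.
Proof.
move=> r0 hr; rewrite (le_trans (expR_sub1_le _))//.
pose s := n%:R * `|row_of_sample x|.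
have s0 : 0 <= s by rewrite mulr_ge0.
have hs : `|dot h x| <= `|h| * s.
  by rewrite dotE (le_trans (normr_inner_le _ _))// mulrCA mulrA.
have ehs : expR `|dot h x| <= expR (r / 2 * s).
  by rewrite ler_expR (le_trans hs)// ler_wpM2r.
have sq : s ^+ 2 <= 8 / r ^+ 2 * expR (r / 2 * s).
  have := @expR_ge1Dxn R (r / 2 * s) 1; rewrite mulr_ge0 ?divr_ge0 ?(ltW r0)// => /(_ isT).
  rewrite -[1.+1]/2%N -[2`!]/2%N => B.
  rewrite -mulrA -[_ * expR _]/(_ * _) mulrA mulrAC ler_pdivlMr ?exprn_gt0//.
  have -> : s ^+ 2 * r ^+ 2 = 8 * ((r / 2 * s) ^+ 2 / 2) by field.
  lra.
have dsq : dot h x ^+ 2 <= `|h| ^+ 2 * s ^+ 2.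
  by rewrite -exprMn -[dot h x ^+ 2]real_normK ?num_real// lerXn2r ?nnegrE ?mulr_ge0.
apply: (@le_trans _ _ (`|h| ^+ 2 * s ^+ 2 * expR (r / 2 * s))).
  by rewrite ler_pM ?sqr_ge0 ?expR_ge0.
apply: (@le_trans _ _ (`|h| ^+ 2 * (8 / r ^+ 2 * expR (r / 2 * s)) * expR (r / 2 * s))).
  by rewrite ler_wpM2r ?expR_ge0// ler_wpM2l ?sqr_ge0.
have -> : `|h| ^+ 2 * (8 / r ^+ 2 * expR (r / 2 * s)) * expR (r / 2 * s) =
    8 / r ^+ 2 * `|h| ^+ 2 * (expR (r / 2 * s) * expR (r / 2 * s)) by ring.
rewrite -expRD ler_wpM2l ?mulr_ge0 ?invr_ge0 ?sqr_ge0//.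
rewrite (le_trans _ (exp_envelope_ge r x))// ler_expR le_eqVlt; apply/orP; left.
by apply/eqP; rewrite /s; field.
Qed.

Lemma expmom_differentiable f eta : tiltable mu f -> nat_space mu eta ->
  differentiable (expmom mu f) eta /\
  grad (expmom mu f) eta = \row_i expmom mu (fun x => tnth x i * f x) eta.
Proof.
move=> tf heta; have [mf hf] := tf.
have [r r0 [hr ie]] := tiltable_envelope onat tf heta.
pose K := 8 / r ^+ 2 * \int[mu]_x (`|tilt f eta x| * exp_envelope r x).
have K0 : 0 <= K.
  rewrite mulr_ge0 ?mulr_ge0 ?invr_ge0 ?sqr_ge0//; apply: Rintegral_ge0 => x _.
  by rewrite mulr_ge0// (le_trans _ (exp_envelope_ge r x))// expR_ge0.
apply: has_grad => e e0.
have K1 : 0 < K + 1 by rewrite ltr_wpDl.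
(* The integrated remainder is at most [K * |h| ^+ 2]; the second radius turns it into [e * |h|],
   with [+ 1] because [K] may vanish. *)
apply/near_ballP; exists (Num.min (r / 2) (e / (K + 1))).
  by rewrite lt_min !divr_gt0.
move=> h; rewrite addr0 lt_min => /andP[h1 h2].
have heh : nat_space mu (h + eta).
  by rewrite addrC; apply: hr; rewrite (le_trans (ltW h1))//; lra.
rewrite -expmom_dot//.
have td := tiltable_dot h tf.
have ih := hf _ heh; have i0 := hf _ heta; have [_ /(_ _ heta) id] := td.
have ihB := integrableB measurableT ih i0.
have ihBB := integrableB measurableT ihB id.
rewrite /expmom -(RintegralB measurableT ih i0) -(RintegralB measurableT ihB id).
apply: (@le_trans _ _ (K * `|h| ^+ 2)); last first.
  rewrite expr2 mulrA ler_wpM2r//.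
  apply: (@le_trans _ _ ((K + 1) * `|h|)); first by rewrite ler_wpM2r// lerDl.
  by rewrite mulrC -ler_pdivlMr// ltW.
rewrite (le_trans (le_normr_Rintegral measurableT ihBB))//.
rewrite /K mulrAC -(RintegralZl _ measurableT ie).
apply: le_Rintegral => //.
- exact: (integrable_norm ihBB).
- exact: (integrableZl measurableT _ ie).
move=> x _; rewrite /tilt dotD expRD.
have -> : f x * (expR (dot h x) * expR (dot eta x)) - f x * expR (dot eta x)
    - dot h x * f x * expR (dot eta x)
  = (expR (dot h x) - 1 - dot h x) * (f x * expR (dot eta x)) by ring.
rewrite normrM [_ * exp_envelope _ _]mulrC mulrA ler_wpM2r//.
by apply: exp_remainder_le => //; exact: ltW.
Qed.

End ExpFamilyCalculus.

(** * Normalized moments, mean and covariance *)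

Section ExpFamilyMoments.
Context {R : realType} {n : nat}.
Variable mu : {measure set (sample R n) -> \bar R}.
Hypothesis onat : open (nat_space mu).
Hypothesis mu_neq0 : ~ {ae mu, forall x, False}.
Implicit Types (eta h u v : 'rV[R]_n) (f g : sample R n -> R) (x : sample R n).

(** The exponential weight never vanishes, so a zero integral would force [f = 0] almost everywhere.
    Used for the partition function and for variances. *)
Lemma expmom_gt0 f eta : tiltable mu f -> nat_space mu eta ->
  (forall x, 0 <= f x) -> ~ {ae mu, forall x, f x = 0} ->
  0 < expmom mu f eta.
Proof.
move=> [mf hf] heta f0 nf.
have t0 x : 0 <= tilt f eta x by rewrite mulr_ge0 ?expR_ge0.
rewrite lt_neqAle Rintegral_ge0 ?andbT//.
apply/eqP => E; apply: nf.
have i0 : (\int[mu]_x (tilt f eta x)%:E = 0)%E.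
  rewrite -[LHS]fineK; first by rewrite -[fine _]/(expmom mu f eta) -E.
  exact: integrable_fin_num (hf _ heta).
have mt : measurable_fun setT (EFin \o tilt f eta).
  exact: measurable_int (hf _ heta).
have /(ae_eq_integral_abs mu measurableT mt) :
    (\int[mu]_(x in setT) `|(EFin \o tilt f eta) x| = 0)%E.
  by rewrite -[RHS]i0; apply: eq_integral => x _ /=; rewrite ger0_norm.
apply: filterS => x /(_ I) /= [] /eqP.
by rewrite mulf_eq0 (gt_eqF (expR_gt0 _)) orbF => /eqP.
Qed.

Lemma partition_gt0 eta : nat_space mu eta -> 0 < expmom mu (cst 1) eta.
Proof.
move=> heta; apply: expmom_gt0 => //; first exact: tiltable1.
by apply: contra_not mu_neq0; apply: filterS => x /eqP; rewrite oner_eq0.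
Qed.

(** Equal to [expect] on tiltable integrands; the quotient form exposes it to the quotient rule. *)
Definition tmean f eta : R := expmom mu f eta / expmom mu (cst 1) eta.

Lemma log_partitionE eta : log_partition mu eta = ln (expmom mu (cst 1) eta).
Proof.
rewrite /log_partition /expmom /Rintegral; congr (ln (fine _)).
by apply: eq_integral => x _; rewrite /tilt mul1r.
Qed.

Lemma qdensE eta x : nat_space mu eta ->
  qdens mu eta x = expR (dot eta x) / expmom mu (cst 1) eta.
Proof.
by move=> heta; rewrite /qdens log_partitionE expRD expRN lnK// posrE partition_gt0.
Qed.

Lemma expectE f eta : tiltable mu f -> nat_space mu eta ->
  expect mu eta (EFin \o f) = tmean f eta.
Proof.
move=> [_ hf] heta; rewrite /tmean /expmom -(RintegralZr _ measurableT (hf _ heta)).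
rewrite /expect /Rintegral; congr fine; apply: eq_integral => x _ /=.
by rewrite -EFinM qdensE// mulrA.
Qed.

Lemma tmeanD f g eta : tiltable mu f -> tiltable mu g -> nat_space mu eta ->
  tmean (fun x => f x + g x) eta = tmean f eta + tmean g eta.
Proof. by move=> *; rewrite /tmean expmomD// mulrDl. Qed.

Lemma tmeanZ (k : R) f eta : tiltable mu f -> nat_space mu eta ->
  tmean (fun x => k * f x) eta = k * tmean f eta.
Proof. by move=> *; rewrite /tmean expmomZ// mulrA. Qed.

Lemma tmean_sum (I : Type) (r : seq I) (F : I -> sample R n -> R) eta :
  (forall i, tiltable mu (F i)) -> nat_space mu eta ->
  tmean (fun x => \sum_(i <- r) F i x) eta = \sum_(i <- r) tmean (F i) eta.
Proof. by move=> *; rewrite /tmean expmom_sum// mulr_suml. Qed.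

Lemma tmean_cst (k : R) eta : nat_space mu eta -> tmean (cst k) eta = k.
Proof.
move=> heta; have -> : cst k = (fun x => k * cst 1 x) :> (sample R n -> R).
  by apply/funext => x; rewrite /= mulr1.
rewrite tmeanZ//; last exact: tiltable1.
by rewrite /tmean divff ?mulr1// gt_eqF// partition_gt0.
Qed.

Lemma tiltable_cst (k : R) : tiltable mu (cst k).
Proof.
have := tiltableZ k (tiltable1 mu); congr tiltable; apply/funext => x.
by rewrite /= mulr1.
Qed.

Lemma tiltable_tnth i : tiltable mu (fun x => tnth x i).
Proof.
have := tiltable_coord onat i (tiltable1 mu); congr tiltable.
by apply/funext => x; rewrite /= mulr1.
Qed.

Lemma tmean_differentiable f eta : tiltable mu f -> nat_space mu eta ->
  differentiable (tmean f) eta /\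
  grad (tmean f) eta = \row_i (tmean (fun x => tnth x i * f x) eta
                             - tmean f eta * tmean (fun x => tnth x i) eta).
Proof.
move=> tf heta; have [dF gF] := expmom_differentiable onat tf heta.
have [dZ gZ] := expmom_differentiable onat (tiltable1 mu) heta.
have Z0 := partition_gt0 heta; have Zn : expmom mu (cst 1) eta != 0 by rewrite gt_eqF.
have dV : differentiable (fun y => (expmom mu (cst 1) y)^-1) eta.
  exact: differentiableV.
split; first exact: differentiableM.
apply/rowP => i; rewrite !mxE deriveM; [|exact: diff_derivable..].
rewrite deriveV//; last exact: diff_derivable.
have := congr1 (fun a : 'rV[R]_n => a 0 i) gF; rewrite !mxE => ->.
have := congr1 (fun a : 'rV[R]_n => a 0 i) gZ; rewrite !mxE => ->.
rewrite (_ : (fun x => tnth x i * cst 1 x) = (fun x => tnth x i)); last first.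
  by apply/funext => x; rewrite /= mulr1.
rewrite /tmean /GRing.scale/=; field; exact: Zn.
Qed.

Lemma meanE i eta : nat_space mu eta ->
  mean mu eta 0 i = tmean (fun x => tnth x i) eta.
Proof. by move=> heta; rewrite mxE -expectE//; exact: tiltable_tnth. Qed.

Lemma inner_mean u eta : nat_space mu eta ->
  inner u (mean mu eta) = tmean (dot u) eta.
Proof.
move=> heta; rewrite /tmean.
have -> : dot u = (fun x => dot u x * cst 1 x).
  by apply/funext => x; rewrite mulr1.
rewrite expmom_dot//; last exact: tiltable1.
rewrite innerC mulr_suml; apply: eq_bigr => i _.
rewrite meanE// mxE /tmean mulrAC; congr (_ * _ / _ ); congr expmom.
by apply/funext => x; rewrite /= mulr1.
Qed.

Lemma tiltable_dot1 u : tiltable mu (dot u).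
Proof.
have := tiltable_dot onat u (tiltable1 mu); congr tiltable.
by apply/funext => x; rewrite /= mulr1.
Qed.

Lemma tiltable_centered i (c : R) f : tiltable mu f ->
  tiltable mu (fun x => (tnth x i - c) * f x).
Proof.
move=> tf; rewrite (_ : (fun _ => _) = fun x => tnth x i * f x + (- c) * f x).
  by apply: tiltableD; [exact: tiltable_coord|exact: tiltableZ].
by apply/funext => x; rewrite mulrDl.
Qed.

Lemma tiltable_covariance i j (c d : R) :
  tiltable mu (fun x => (tnth x i - c) * (tnth x j - d)).
Proof.
apply: tiltable_centered.
by apply: tiltableD; [exact: tiltable_tnth|exact: tiltable_cst].
Qed.

Lemma covE i j eta : nat_space mu eta ->
  cov mu eta i j = tmean (fun x => tnth x i * tnth x j) eta
    - tmean (fun x => tnth x j) eta * tmean (fun x => tnth x i) eta.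
Proof.
move=> heta; rewrite mxE -[X in expect _ _ X]/(EFin \o (fun x => _ * _)).
rewrite expectE//; last exact: tiltable_covariance.
rewrite !meanE//; set a := tmean (fun x => tnth x j) eta.
set b := tmean (fun x => tnth x i) eta.
have tx k : tiltable mu (fun x => tnth x k) by exact: tiltable_tnth.
have txx : tiltable mu (fun x => tnth x i * tnth x j).
  by apply: tiltable_coord => //; exact: tx.
rewrite (_ : (fun _ => _) = fun x => (tnth x i * tnth x j + (- a) * tnth x i)
  + ((- b) * tnth x j + cst (a * b) x)); last first.
  by apply/funext => x /=; ring.
have tZ k (c : R) : tiltable mu (fun x => c * tnth x k) by exact: tiltableZ.
have tC := tiltable_cst (a * b).
have tU := tiltableD txx (tZ i (- a)); have tV := tiltableD (tZ j (- b)) tC.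
rewrite !tmeanD// tmean_cst// !tmeanZ// -/a -/b; ring.
Qed.

Lemma cov_sym eta : (cov mu eta)^T = cov mu eta.
Proof.
apply/matrixP => i j; rewrite !mxE; congr (expect _ _ _); apply/funext => x.
by rewrite mulrC.
Qed.

Lemma mean_differentiable j eta : nat_space mu eta ->
  differentiable (fun y => mean mu y 0 j) eta /\
  forall i, 'D_(delta_mx 0 i) (fun y => mean mu y 0 j) eta = cov mu eta i j.
Proof.
move=> heta; have [d g] := tmean_differentiable (tiltable_tnth j) heta.
have E : \forall y \near eta, tmean (fun x => tnth x j) y = mean mu y 0 j.
  by have := open_nbhs_nbhs (conj onat heta); apply: filterS => y /meanE ->.
split=> [|i]; first exact: near_eq_differentiable d.
rewrite -(near_eq_derive _ E) covE//.
by have := congr1 (fun a : 'rV[R]_n => a 0 i) g; rewrite !mxE.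
Qed.

Lemma quadratic_covE u eta : nat_space mu eta ->
  inner (u *m cov mu eta) u =
  tmean (fun x => (dot u x - inner u (mean mu eta)) ^+ 2) eta.
Proof.
move=> heta; set m := mean mu eta.
rewrite (_ : (fun x => _ ^+ 2) = fun x => \sum_i \sum_j
    (u 0 i * u 0 j) * ((tnth x i - m 0 i) * (tnth x j - m 0 j))); last first.
  apply/funext => x.
  have -> : dot u x - inner u m = \sum_i u 0 i * (tnth x i - m 0 i).
    by rewrite -sumrB; apply: eq_bigr => i _; rewrite mulrBr.
  rewrite expr2 mulr_suml; apply: eq_bigr => i _.
  by rewrite mulr_sumr; apply: eq_bigr => j _; rewrite mulrACA.
have tc i j : tiltable mu (fun x => (tnth x i - m 0 i) * (tnth x j - m 0 j)).
  exact: tiltable_covariance.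
rewrite tmean_sum//; last by move=> i; apply: tiltable_sum => j; exact: tiltableZ.
apply: eq_bigr => i _; rewrite tmean_sum//; last by move=> j; exact: tiltableZ.
rewrite mxE mulr_suml; apply: eq_bigr => j _; rewrite tmeanZ//.
rewrite -expectE// [in LHS]mxE mulrAC [in RHS](mulrC (u 0 i)) [in RHS]mulrAC.
rewrite -mulrA [RHS]mulrAC -mulrA; congr (_ * (_ * _)).
by congr expect; apply/funext => x /=; rewrite mulrC.
Qed.

(** The quadratic form at [u] is the variance of [dot u]; were it zero, [dot u] would be constant
    almost everywhere, against minimality. *)
Lemma cov_posdef eta : minimal_family mu -> nat_space mu eta ->
  posdef (cov mu eta).
Proof.
move=> hmin heta u u0; rewrite -innerE quadratic_covE//.
set c := inner _ _; rewrite divr_gt0 ?partition_gt0//.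
apply: expmom_gt0 => //.
- rewrite (_ : (fun _ => _) = fun x => dot u x * dot u x + ((- 2 * c) * dot u x + cst (c ^+ 2) x)).
    apply: tiltableD; first by apply: tiltable_dot => //; exact: tiltable_dot1.
    apply: tiltableD; last exact: tiltable_cst.
    by apply: tiltableZ; exact: tiltable_dot1.
  by apply/funext => x /=; ring.
- by move=> x; rewrite sqr_ge0.
- apply: contra_not (hmin u c u0); apply: filterS => x /eqP.
  by rewrite sqrf_eq0 subr_eq0 => /eqP.
Qed.

End ExpFamilyMoments.

(** * The mean map and its inverse *)

Section MeanMap.
Context {R : realType} {n : nat}.
Variable mu : {measure set (sample R n) -> \bar R}.
Hypothesis onat : open (nat_space mu).
Hypothesis mu_neq0 : ~ {ae mu, forall x, False}.
Hypothesis hmin : minimal_family mu.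
Implicit Types (eta h u v m : 'rV[R]_n) (x : sample R n).

#[local] Opaque mean cov.

(* Jensen's inequality for [exp] under [qdens mu eta]. *)
Lemma partition_ge eta h : nat_space mu eta -> nat_space mu (eta + h) ->
  expR (inner (mean mu eta) h) * expmom mu (cst 1) eta
    <= expmom mu (cst 1) (eta + h).
Proof.
move=> h0 h1; have Z0 := partition_gt0 mu_neq0 h0.
rewrite innerC inner_mean//; set y := tmean mu (dot h) eta.
have yE : expmom mu (dot h) eta = y * expmom mu (cst 1) eta.
  by rewrite /y /tmean divfK// gt_eqF.
have td := tiltable_dot1 onat h.
have tZ := tiltableZ (expR y) td; have tC := tiltable_cst mu (expR y * (1 - y)).
have tg := tiltableD tC tZ.
(* The right side integrates the tangent line of [expR] at [y], the mean of [dot h]; it lies below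
   [expR (dot h x)] pointwise. *)
have -> : expR y * expmom mu (cst 1) eta =
    expmom mu (fun x => cst (expR y * (1 - y)) x + expR y * dot h x) eta.
  rewrite expmomD// expmomZ// yE.
  rewrite (_ : cst (expR y * (1 - y)) = fun x => expR y * (1 - y) * cst 1 x).
    by rewrite expmomZ//; [ring|exact: tiltable1].
  by apply/funext => x; rewrite /= mulr1.
apply: le_Rintegral => //; [exact: tg.2|exact: (tiltable1 mu).2|].
move=> x _; rewrite /tilt mul1r dotD expRD mulrC ler_wpM2l ?expR_ge0//=.
rewrite -mulrDr -[leRHS](_ : expR y * expR (dot h x - y) = _); last first.
  by rewrite -expRD addrC subrK.
rewrite ler_wpM2l ?expR_ge0//.
by have := expR_ge1Dx (dot h x - y); lra.
Qed.

(** Jensen's inequality from each end point towards the other; the partition functions cancel when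
    the two are combined. *)
Lemma mean_monotone eta h : nat_space mu eta -> nat_space mu (eta + h) ->
  0 <= inner (mean mu (eta + h) - mean mu eta) h.
Proof.
move=> h0 h1; have A := partition_ge h0 h1.
have h0' : nat_space mu (eta + h + - h) by rewrite addrK.
have B := partition_ge h1 h0'.
rewrite addrK innerNr in B.
have Z0 := partition_gt0 mu_neq0 h0; have Z1 := partition_gt0 mu_neq0 h1.
rewrite innerBl subr_ge0 -ler_expR -(ler_pM2r Z0).
apply: (le_trans A).
have := ler_wpM2l (expR_ge0 (inner (mean mu (eta + h)) h)) B.
by rewrite mulrA -expRD subrr expR0 mul1r.
Qed.

Lemma mean_coercive eta : nat_space mu eta ->
  exists c, exists2 r, 0 < c /\ 0 < r & forall h, `|h| <= r ->
    nat_space mu (eta + h) /\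
    c * `|h| ^+ 2 <= inner (mean mu (eta + h) - mean mu eta) h.
Proof.
move=> heta; have pV := cov_posdef onat mu_neq0 hmin heta.
have [c c0 hc] := posdef_coercive (cov_sym mu eta) pV.
(* The coordinatewise error [e * |h|] acquires a factor [n] in the inner product and so costs at
   most half of [c]. *)
pose e := c / (2 * (n%:R + 1)).
have n1 : 0 < n%:R + 1 :> R by rewrite ltr_wpDl.
have e0 : 0 < e by rewrite divr_gt0// mulr_gt0.
have A0 i : \forall h \near (0 : 'rV[R]_n),
    `|mean mu (h + eta) 0 i - mean mu eta 0 i
      - inner (grad (fun y => mean mu y 0 i) eta) h| <= e * `|h|.
  exact: (grad_approx (mean_differentiable onat mu_neq0 i heta).1 e0).
have : \forall h \near (0 : 'rV[R]_n), forall i : 'I_n,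
    `|mean mu (h + eta) 0 i - mean mu eta 0 i
      - inner (grad (fun y => mean mu y 0 i) eta) h| <= e * `|h|.
  exact: (filter_forall _ A0).
move=> /near_ballP[r r0 A].
have /near_ballP[r' r'0 B] := open_nbhs_nbhs (conj onat heta).
have m0 : 0 < Num.min r r' by rewrite lt_min r0.
exists (c / 2), (Num.min r r' / 2); first by rewrite !divr_gt0.
move=> h hr; have {hr} : `|h| < Num.min r r'.
  by rewrite (le_lt_trans hr)// ltr_pdivrMr// ltr_pMr// ltr1n.
rewrite lt_min => /andP[hr hr']; rewrite addrC; split; first exact: B.
pose d := mean mu (h + eta) - mean mu eta - h *m cov mu eta.
have dle : `|d| <= e * `|h|.
  apply: norm_rV_le => [|i]; first by rewrite mulr_ge0// ltW.
  have dE (a b k : 'rV[R]_n) : (a - b - k) 0 i = a 0 i - b 0 i - k 0 i.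
    by rewrite !mxE.
  have gE : inner (grad (fun y => mean mu y 0 i) eta) h = (h *m cov mu eta) 0 i.
    rewrite [RHS]mxE; apply: eq_bigr => k _.
    by rewrite [grad _ _ 0 k]mxE (mean_differentiable onat mu_neq0 i heta).2 mulrC.
  by have := A h hr i; rewrite addr0 gE -dE.
have -> : inner (mean mu (h + eta) - mean mu eta) h
    = inner (h *m cov mu eta) h + inner d h.
  by rewrite -innerDl /d [h *m _ + _]addrC subrK.
have ch := hc h.
have : `|inner d h| <= c / 2 * `|h| ^+ 2.
  rewrite (le_trans (normr_inner_le _ _))// expr2 mulrA ler_wpM2r//.
  apply: (@le_trans _ _ (n%:R * (e * `|h|))); first by rewrite ler_wpM2l.
  rewrite mulrA ler_wpM2r// /e.
  rewrite mulrA ler_pdivrMr ?mulr_gt0//.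
  have -> : c / 2 * (2 * (n%:R + 1)) = c * (n%:R + 1) by field.
  by rewrite mulrC ler_pM2l// lerDl.
rewrite ler_norml => /andP[+ _]; lra.
Qed.

(* Monotonicity along rays upgrades the local bound [mean_coercive] to one
   valid on the whole natural parameter space. *)
Lemma mean_expansive eta : nat_space mu eta ->
  exists c, exists2 r, 0 < c /\ 0 < r & forall h, nat_space mu (eta + h) ->
    c * Num.min r `|h| <= n%:R * `|mean mu (eta + h) - mean mu eta|.
Proof.
move=> heta; have [c [r [c0 r0] hc]] := mean_coercive heta.
exists c, r => // h hh; set d := mean mu (eta + h) - _.
have [->|h0] := eqVneq h 0.
  by rewrite normr0 (min_idPr _) ?(ltW r0)// mulr0 mulr_ge0.
have nh : 0 < `|h| by rewrite normr_gt0.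
rewrite -(ler_pM2r nh) (le_trans _ (normr_inner_le d h))//.
rewrite (le_trans _ (ler_norm _))//.
have [hr|hr] := leP r `|h|; last first.
  by have [_] := hc h (ltW hr); rewrite expr2 mulrA.
(* The point [eta + s *: h] lies on the ray at distance exactly [r], where the local bound still
   applies. *)
pose s := r / `|h|.
have s0 : 0 < s by rewrite divr_gt0.
have s1 : s <= 1 by rewrite ler_pdivrMr// mul1r.
have nsh : `|s *: h| = r by rewrite normrZ gtr0_norm// divfK// gt_eqF.
have [hs B0] : nat_space mu (eta + s *: h) /\ c * `|s *: h| ^+ 2 <=
    inner (mean mu (eta + s *: h) - mean mu eta) (s *: h).
  by apply: hc; rewrite nsh.
have B : c * r ^+ 2 <= s * inner (mean mu (eta + s *: h) - mean mu eta) h.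
  by rewrite -innerZr -nsh.
have : inner (mean mu (eta + s *: h) - mean mu eta) h <= inner d h.
  (* Monotonicity between the points at [s] and at [1], whose difference is [(1 - s) *: h]. The
     factor can be cancelled unless [s = 1], where the two points coincide. *)
  have : 0 <= (1 - s) * inner (mean mu (eta + h) - mean mu (eta + s *: h)) h.
    have hE : eta + s *: h + (1 - s) *: h = eta + h.
      by rewrite -addrA -scalerDl [s + _]addrC subrK scale1r.
    have P w : eta + s *: h + (1 - s) *: h = w -> nat_space mu w ->
        0 <= (1 - s) * inner (mean mu w - mean mu (eta + s *: h)) h.
      move=> <- hw.
      have := mean_monotone hs hw.
      by rewrite innerZr.
    exact: P hE hh.
  have [->|s1'] := eqVneq s 1; first by rewrite scale1r.
  rewrite pmulr_rge0; last by rewrite subr_gt0 lt_neqAle s1'.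
  move=> Q; rewrite -subr_ge0 -innerBl; move: Q.
  suff -> : d - (mean mu (eta + s *: h) - mean mu eta)
      = mean mu (eta + h) - mean mu (eta + s *: h) by [].
  by rewrite /d opprB addrA subrK.
apply: le_trans; rewrite -(ler_pM2l s0) (le_trans _ B)//.
by rewrite le_eqVlt; apply/orP; left; apply/eqP; rewrite /s; field; rewrite gt_eqF.
Qed.

Lemma nat_of_meanP m : mean_space mu m ->
  nat_space mu (nat_of_mean mu m) /\ mean mu (nat_of_mean mu m) = m.
Proof.
move=> [eta heta <-].
by apply: (@xgetPex _ 0 [set e | nat_space mu e /\ mean mu e = mean mu eta]); exists eta.
Qed.

Lemma nat_of_mean_differentiable m j : (mean_space mu)° m ->
  differentiable (fun y => nat_of_mean mu y 0 j) m /\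
  grad (fun y => nat_of_mean mu y 0 j) m =
    \row_i invmx (cov mu (nat_of_mean mu m)) i j.
Proof.
move=> mint; have hm := nbhs_singleton mint; have [hN mN] := nat_of_meanP hm.
have [c [r [c0 r0] H]] := mean_expansive hN.
have VE : \matrix_(i, k) 'D_(delta_mx 0 i)
    (fun y => mean mu y 0 k) (nat_of_mean mu m) = cov mu (nat_of_mean mu m).
  by apply/matrixP => i k; rewrite mxE (mean_differentiable onat mu_neq0 k hN).2.
have n1 : 0 < n%:R + 1 :> R by rewrite ltr_wpDl.
have := @differentiable_right_inverse R n (mean mu) (nat_of_mean mu) m (n%:R / c).
rewrite /= VE; apply.
- by move=> k; have [] := mean_differentiable onat mu_neq0 k hN.
- exact/posdef_unitmx/cov_posdef.
- by apply: filterS mint => y /nat_of_meanP[].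
have /near_ballP[d d0 D] := mint.
(* The second radius forces the minimum in [mean_expansive] to be the displacement of the natural
   parameter rather than [r], which leaves the Lipschitz constant [n%:R / c]. *)
apply/near_ballP; exists (Num.min d (c * r / (n%:R + 1))).
  by rewrite lt_min d0 divr_gt0// mulr_gt0.
move=> h; rewrite lt_min addrK => /andP[/D/nat_of_meanP[hy my] hr].
have := H (nat_of_mean mu (h + m) - nat_of_mean mu m).
rewrite addrC subrK my mN addrK => /(_ hy).
have [rh|rh] := leP r _; last by rewrite mulrAC ler_pdivlMr// mulrC.
rewrite ltr_pdivlMr// in hr.
have hn := normr_ge0 h; lra.
Qed.

End MeanMap.

(** * The variational objective *)

(** [A] and [A'] stand for the log partition function at [N] and [N'], so [A - inner N m] is the
    entropy, minus the convex conjugate. The hypotheses are supporting hyperplanes at [N'] and at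
    [N]; they place the remainder between [- inner (N' - N) h] and [0]. *)
Lemma conjugate_sandwich {R : realType} {n : nat} (A A' : R)
    (N N' m h : 'rV[R]_n) :
  A' + inner (h + m) (N - N') <= A -> A + inner m (N' - N) <= A' ->
  `|A' - inner N' (h + m) - (A - inner N m) - inner (- N) h|
    <= `|inner (N' - N) h|.
Proof.
have -> : inner N' (h + m) = inner N' h + inner N' m by rewrite linearD.
rewrite innerDl !innerBr !(innerC h) !(innerC m) innerBl innerNl.
move: (inner N' h) (inner N' m) (inner N h) (inner N m) => a b c d.
move=> up lo; rewrite ler0_norm; last by lra.
by apply: le_trans (ler_norm _); lra.
Qed.

Section Objective.
Context {R : realType} {n : nat}.
Variable mu : {measure set (sample R n) -> \bar R}.
Hypothesis onat : open (nat_space mu).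
Hypothesis mu_neq0 : ~ {ae mu, forall x, False}.
Hypothesis hmin : minimal_family mu.
Implicit Types (eta h u v m t : 'rV[R]_n) (x : sample R n)
  (p f g : sample R n -> R).

#[local] Opaque mean cov.

Lemma log_partition_ge eta h : nat_space mu eta -> nat_space mu (eta + h) ->
  log_partition mu eta + inner (mean mu eta) h <= log_partition mu (eta + h).
Proof.
move=> h0 h1; have := partition_ge onat mu_neq0 h0 h1.
have := partition_gt0 mu_neq0 h0; have := partition_gt0 mu_neq0 h1.
rewrite !log_partitionE; move: (inner _ _) (expmom _ _ _) (expmom _ _ _).
move=> y Z1 Z0 Z10 Z00; rewrite -ler_ln ?posrE ?mulr_gt0 ?expR_gt0//.
by rewrite lnM ?posrE ?expR_gt0// expRK addrC.
Qed.

Lemma entropyE m : mean_space mu m ->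
  entropy mu m = log_partition mu (nat_of_mean mu m) - inner (nat_of_mean mu m) m.
Proof.
move=> /nat_of_meanP[hN mN]; rewrite /entropy.
move: (nat_of_mean mu m) hN mN => eta hN mN.
have -> : (fun x => lne (qdens mu eta x)%:E) =
    EFin \o (fun x => dot eta x + cst (- log_partition mu eta) x).
  by apply/funext => x; rewrite lne_EFin ?expR_gt0// expRK.
have td := tiltable_dot1 onat eta.
have tc := tiltable_cst mu (- log_partition mu eta).
rewrite expectE ?tmeanD ?tmean_cst//; last exact: tiltableD.
by rewrite -inner_mean// mN opprD opprK addrC.
Qed.

Lemma near_interior m : (mean_space mu)° m -> \forall y \near m, (mean_space mu)° y.
Proof.
by move=> mint; exact: (open_nbhs_nbhs (conj (open_interior _) mint)).
Qed.

Lemma entropy_differentiable m : (mean_space mu)° m ->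
  differentiable (entropy mu) m /\ grad (entropy mu) m = - nat_of_mean mu m.
Proof.
move=> mint; apply: has_grad => e e0.
have n1 : 0 < n%:R + 1 :> R by rewrite ltr_wpDl.
have cN : {for m, continuous (nat_of_mean mu)}.
  apply: differentiable_continuous; apply: differentiable_rV => j.
  by have [] := nat_of_mean_differentiable onat mu_neq0 hmin j mint.
have : \forall y \near m, `|nat_of_mean mu m - nat_of_mean mu y| < e / (n%:R + 1).
  by move/cvgrPdist_lt : cN; apply; rewrite divr_gt0.
move=> /near_ballP[r r0 A]; have /near_ballP[d d0 D] := mint.
apply/near_ballP; exists (Num.min r d); first by rewrite lt_min r0.
move=> h; rewrite addr0 lt_min => /andP[/A hr /D hd].
have hm := nbhs_singleton mint.
rewrite !entropyE//.
have [a a'] := nat_of_meanP hm; have [b b'] := nat_of_meanP hd.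
move: (nat_of_mean mu m) (nat_of_mean mu (h + m)) hr a a' b b'.
move=> N N' hr a a' b b'.
apply: (@le_trans _ _ `|inner (N' - N) h|).
  apply: conjugate_sandwich.
    have := @log_partition_ge N' (N - N') b; rewrite b' addrC subrK; exact.
  have := @log_partition_ge N (N' - N) a; rewrite a' addrC subrK; exact.
rewrite (le_trans (normr_inner_le _ _))// ler_wpM2r// distrC.
rewrite (le_trans (ler_wpM2l (ler0n _ _) (ltW hr)))//.
by rewrite mulrCA ler_piMr ?(ltW e0)// ler_pdivrMr// mul1r lerDl.
Qed.

Lemma measurable_lne_EFin g : measurable_fun setT g ->
  measurable_fun setT (fun x => lne (g x)%:E).
Proof.
move=> mg; apply: measurable_fun_ifT; first exact: measurable_fun_ler.
  exact: measurable_cst.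
by apply/measurable_EFinP; apply: measurableT_comp => //; exact: measurable_ln.
Qed.

(** Where [p] is not positive the integrand is [-oo], while an integrable function is finite almost
    everywhere. *)
Lemma density_pos_ae p eta : log_integrable mu p -> nat_space mu eta ->
  {ae mu, forall x, 0 < p x}.
Proof.
move=> lp heta; have := integrable_ae measurableT (lp _ heta).
apply: filterS => x /(_ I); have [//|p0] := ltP 0 (p x).
by rewrite /= p0 mulNyr gtr0_sg ?expR_gt0// mul1e.
Qed.

Lemma tiltable_ln p : measurable_fun setT p -> log_integrable mu p ->
  tiltable mu (fun x => ln (p x)).
Proof.
move=> mp lp; have ml : measurable_fun setT (fun x => ln (p x)).
  by apply: measurableT_comp => //; exact: measurable_ln.
split=> // eta heta; have := integrableZl measurableT (expmom mu (cst 1) eta) (lp _ heta).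
have Z0 := partition_gt0 mu_neq0 heta.
apply: le_integrable => //; first by apply/measurable_EFinP; exact: measurable_tilt.
(* Where [p] is not positive the dominating function is infinite; elsewhere the partition function
   cancels the normalization of [qdens] and the two sides agree. *)
move=> x _; rewrite /tilt /=; have [p0|p0] := leP (p x) 0.
  rewrite mulNyr gtr0_sg ?expR_gt0// mul1e mulrNy gtr0_sg// mul1e /=.
  exact: leey.
rewrite lee_fin qdensE// le_eqVlt; apply/orP; left; apply/eqP; congr `|_|.
by field; rewrite gt_eqF.
Qed.

Lemma expect_lne_ae f g eta : nat_space mu eta -> tiltable mu f ->
  measurable_fun setT g -> {ae mu, forall x, lne (g x)%:E = (f x)%:E} ->
  expect mu eta (fun x => lne (g x)%:E) = tmean mu f eta.
Proof.
move=> heta tf mg fg; rewrite -expectE// /expect; congr fine.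
have mq : measurable_fun setT (EFin \o qdens mu eta).
  apply/measurable_EFinP; apply: measurableT_comp => //.
  by apply: measurable_funB => //; exact: measurable_dot.
apply: ae_eq_integral => //.
- by apply: emeasurable_funM => //; exact: measurable_lne_EFin.
- by apply: emeasurable_funM => //; apply/measurable_EFinP; case: tf.
- by apply: filterS fg => x E _; congr (_ * _)%E; exact: E.
Qed.

Lemma exp_loglikE p m : measurable_fun setT p -> log_integrable mu p ->
  mean_space mu m ->
  exp_loglik mu p m = tmean mu (fun x => ln (p x)) (nat_of_mean mu m).
Proof.
move=> mp lp /nat_of_meanP[hN _]; apply: expect_lne_ae => //.
  exact: tiltable_ln.
by apply: filterS (density_pos_ae lp hN) => x p0; rewrite lne_EFin.
Qed.

(** The entropy does not involve the target, and tilting adds to the log density an affine function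
    of the statistics, whose expectation depends on [m] only through [inner t m]. *)
Lemma objective_perturbE p t m : measurable_fun setT p -> log_integrable mu p ->
  mean_space mu m ->
  objective mu (perturb mu p t) m = objective mu p m + (inner t m - log_norm mu p t).
Proof.
move=> mp lp hm; have [hN mN] := nat_of_meanP hm.
rewrite /objective [RHS]addrAC (exp_loglikE mp lp hm); congr (_ + _).
rewrite /exp_loglik; have tl := tiltable_ln mp lp.
have td := tiltable_dot1 onat t; have tc := tiltable_cst mu (- log_norm mu p t).
have tdc := tiltableD td tc; have tf := tiltableD tl tdc.
rewrite (expect_lne_ae hN tf).
- by rewrite !tmeanD// tmean_cst// -inner_mean// mN.
- apply: measurable_funM => //; apply: measurableT_comp => //.
  by apply: measurable_funB => //; exact: measurable_dot.
apply: filterS (density_pos_ae lp hN) => x p0.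
rewrite lne_EFin ?mulr_gt0 ?expR_gt0//.
by rewrite lnM ?posrE ?expR_gt0// expRK.
Qed.

End Objective.

(** * First and second derivatives of the objective *)

Section ObjectiveCalculus.
Context {R : realType} {n : nat}.
Variable mu : {measure set (sample R n) -> \bar R}.
Hypothesis onat : open (nat_space mu).
Hypothesis mu_neq0 : ~ {ae mu, forall x, False}.
Hypothesis hmin : minimal_family mu.
Implicit Types (eta h u v m t : 'rV[R]_n) (x : sample R n)
  (p f g : sample R n -> R).

#[local] Opaque mean cov tmean nat_of_mean.
Local Notation N := (nat_of_mean mu).

Lemma nat_of_mean_differentiable_rV m : (mean_space mu)° m -> differentiable N m.
Proof.
move=> mint; apply: differentiable_rV => j.
by have [] := nat_of_mean_differentiable onat mu_neq0 hmin j mint.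
Qed.

Lemma derive_nat_of_mean m i j : (mean_space mu)° m ->
  ('D_(delta_mx 0 j) N m) 0 i = invmx (cov mu (N m)) j i.
Proof.
move=> mint; rewrite -derive_coord_rV; last exact: nat_of_mean_differentiable_rV.
have [_ /(congr1 (fun a : 'rV[R]_n => a 0 j))] :=
  nat_of_mean_differentiable onat mu_neq0 hmin i mint.
by rewrite [in LHS]mxE [in RHS]mxE.
Qed.

Lemma tmean_comp_differentiable f m : tiltable mu f -> (mean_space mu)° m ->
  differentiable (fun y => tmean mu f (N y)) m.
Proof.
move=> tf mint; have [hN _] := nat_of_meanP (nbhs_singleton mint).
apply: (@differentiable_comp _ _ _ _ N (tmean mu f)).
  exact: nat_of_mean_differentiable_rV.
by have [] := tmean_differentiable onat mu_neq0 tf hN.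
Qed.

Lemma derive_tmean_comp f m j : tiltable mu f -> (mean_space mu)° m ->
  'D_(delta_mx 0 j) (fun y => tmean mu f (N y)) m =
  \sum_i (tmean mu (fun x => tnth x i * f x) (N m)
      - tmean mu f (N m) * tmean mu (fun x => tnth x i) (N m))
    * invmx (cov mu (N m)) j i.
Proof.
move=> tf mint; have [hN _] := nat_of_meanP (nbhs_singleton mint).
have [dG gG] := tmean_differentiable onat mu_neq0 tf hN.
have dN := nat_of_mean_differentiable_rV mint.
rewrite -[LHS]/('D_(delta_mx 0 j) (tmean mu f \o N) m) derive_comp_rV// gG.
apply: eq_bigr => i _; rewrite derive_nat_of_mean//; congr (_ * _).
by rewrite mxE.
Qed.

Lemma invmx_cov_differentiable m i j : (mean_space mu)° m ->
  differentiable (fun y => invmx (cov mu (N y)) i j) m.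
Proof.
move=> mint; apply: differentiable_invmx => [|k l].
  apply: filterS mint => y /nat_of_meanP[hN _].
  exact/posdef_unitmx/cov_posdef.
apply: (@near_eq_differentiable _ _ (fun y =>
    tmean mu (fun x => tnth x k * tnth x l) (N y)
    - tmean mu (fun x => tnth x l) (N y) * tmean mu (fun x => tnth x k) (N y))).
  by apply: filterS mint => y /nat_of_meanP[hN _]; rewrite covE.
have tt i' := tiltable_tnth onat i'.
apply: differentiableB.
  by apply: tmean_comp_differentiable => //; exact: tiltable_coord.
by apply: differentiableM; exact: tmean_comp_differentiable.
Qed.

(** The formula for the first derivative holds throughout the interior, hence near [m], and is built
    from expectations of tiltable functions and entries of the inverse covariance, so it can be
    differentiated again. *)
Lemma derive_tmean_comp_differentiable f m j :
  tiltable mu f -> (mean_space mu)° m ->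
  differentiable (fun y => 'D_(delta_mx 0 j) (fun z => tmean mu f (N z)) y) m.
Proof.
move=> tf mint.
apply: (@near_eq_differentiable _ _ (fun y =>
  \sum_i (tmean mu (fun x => tnth x i * f x) (N y)
      - tmean mu f (N y) * tmean mu (fun x => tnth x i) (N y))
    * invmx (cov mu (N y)) j i)).
  by apply: filterS (near_interior mint) => y yint; rewrite derive_tmean_comp.
apply: differentiable_bigsum => i; apply: differentiableM.
  apply: differentiableB.
    by apply: tmean_comp_differentiable => //; exact: tiltable_coord.
  by apply: differentiableM; apply: tmean_comp_differentiable => //;
    exact: tiltable_tnth.
exact: invmx_cov_differentiable.
Qed.

Section LogLikelihood.
Variable p : sample R n -> R.
Hypotheses (mp : measurable_fun setT p) (lp : log_integrable mu p).

Lemma exp_loglik_near m : (mean_space mu)° m ->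
  \forall y \near m, tmean mu (fun x => ln (p x)) (N y) = exp_loglik mu p y.
Proof. by apply: filterS => y hy; rewrite exp_loglikE. Qed.

Lemma exp_loglik_differentiable m : (mean_space mu)° m ->
  differentiable (exp_loglik mu p) m.
Proof.
move=> mint; apply: near_eq_differentiable (exp_loglik_near mint) _.
by apply: tmean_comp_differentiable => //; exact: tiltable_ln.
Qed.

Lemma derive_exp_loglik_differentiable m j : (mean_space mu)° m ->
  differentiable (fun y => 'D_(delta_mx 0 j) (exp_loglik mu p) y) m.
Proof.
move=> mint; have tl := tiltable_ln mu_neq0 mp lp.
apply: near_eq_differentiable (derive_tmean_comp_differentiable j tl mint).
apply: filterS (near_interior mint) => y yint.
exact: near_eq_derive (exp_loglik_near yint).
Qed.

Lemma derive_entropy m j : (mean_space mu)° m ->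
  'D_(delta_mx 0 j) (entropy mu) m = - N m 0 j.
Proof.
move=> mint; have [_ g] := entropy_differentiable onat mu_neq0 hmin mint.
have := congr1 (fun a : 'rV[R]_n => a 0 j) g.
by rewrite [in LHS]mxE [in RHS]mxE.
Qed.

Lemma derive_entropy_near m j : (mean_space mu)° m ->
  \forall y \near m, - N y 0 j = 'D_(delta_mx 0 j) (entropy mu) y.
Proof.
by move=> /near_interior; apply: filterS => y yint; rewrite derive_entropy.
Qed.

Lemma derive_entropy_differentiable m j : (mean_space mu)° m ->
  differentiable (fun y => 'D_(delta_mx 0 j) (entropy mu) y) m.
Proof.
move=> mint; apply: near_eq_differentiable (derive_entropy_near j mint) _.
apply: differentiableN; apply: differentiable_coord_rV.
exact: nat_of_mean_differentiable_rV.
Qed.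

Lemma hessian_entropy m : (mean_space mu)° m ->
  hessian (entropy mu) m = - invmx (cov mu (N m)).
Proof.
move=> mint; apply/matrixP => i j; rewrite [LHS]mxE [RHS]mxE.
have dN := nat_of_mean_differentiable_rV mint.
have dNj : differentiable (fun y => N y 0 j) m by exact: differentiable_coord_rV.
rewrite -(near_eq_derive _ (derive_entropy_near j mint)).
rewrite deriveN; last exact: diff_derivable.
by rewrite derive_coord_rV// derive_nat_of_mean.
Qed.

Lemma objective_differentiable m : (mean_space mu)° m ->
  differentiable (objective mu p) m.
Proof.
move=> mint; apply: differentiableD; first exact: exp_loglik_differentiable.
by have [] := entropy_differentiable onat mu_neq0 hmin mint.
Qed.

Lemma derive_objective m j : (mean_space mu)° m ->
  'D_(delta_mx 0 j) (objective mu p) m =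
  'D_(delta_mx 0 j) (exp_loglik mu p) m + 'D_(delta_mx 0 j) (entropy mu) m.
Proof.
move=> mint; apply: deriveD; apply: diff_derivable.
  exact: exp_loglik_differentiable.
by have [] := entropy_differentiable onat mu_neq0 hmin mint.
Qed.

Lemma derive_objective_near m j : (mean_space mu)° m ->
  \forall y \near m,
  'D_(delta_mx 0 j) (exp_loglik mu p) y + 'D_(delta_mx 0 j) (entropy mu) y =
  'D_(delta_mx 0 j) (objective mu p) y.
Proof.
by move=> /near_interior; apply: filterS => y yint; rewrite derive_objective.
Qed.

Lemma derive_objective_differentiable m j : (mean_space mu)° m ->
  differentiable (fun y => 'D_(delta_mx 0 j) (objective mu p) y) m.
Proof.
move=> mint; apply: near_eq_differentiable (derive_objective_near j mint) _.
apply: differentiableD; first exact: derive_exp_loglik_differentiable.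
exact: derive_entropy_differentiable.
Qed.

Lemma hessian_objective m : (mean_space mu)° m ->
  hessian (objective mu p) m =
  hessian (exp_loglik mu p) m - invmx (cov mu (N m)).
Proof.
move=> mint; rewrite -hessian_entropy//; apply/matrixP => i j.
rewrite [LHS]mxE [RHS]mxE [hessian _ _ i j]mxE [X in _ = _ + X]mxE.
rewrite -(near_eq_derive _ (derive_objective_near j mint)).
apply: deriveD; apply: diff_derivable.
  exact: derive_exp_loglik_differentiable.
exact: derive_entropy_differentiable.
Qed.

Lemma grad_objective_perturb t m : (mean_space mu)° m ->
  grad (objective mu (perturb mu p t)) m = grad (objective mu p) m + t.
Proof.
move=> mint; apply/rowP => j; rewrite [LHS]mxE [RHS]mxE [grad _ _ _ _]mxE.
have E : \forall y \near m, objective mu p y + (inner t y - log_norm mu p t) =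
    objective mu (perturb mu p t) y.
  by apply: filterS mint => y hy; rewrite objective_perturbE.
rewrite -(near_eq_derive _ E).
have [dB gB] : differentiable (fun y => inner t y - log_norm mu p t) m /\
    grad (fun y => inner t y - log_norm mu p t) m = t.
  apply: has_grad => e e0; apply/near_ballP; exists 1 => // h _; rewrite addr0.
  rewrite (_ : _ - _ - _ = 0) ?normr0 ?mulr_ge0 ?(ltW e0)//.
  by rewrite linearD/=; ring.
rewrite deriveD; last 2 first.
  by apply: diff_derivable; exact: objective_differentiable.
  exact: diff_derivable.
have := congr1 (fun a : 'rV[R]_n => a 0 j) gB.
by rewrite [in LHS]mxE => ->.
Qed.

Lemma hessian_objective_sym m : (mean_space mu)° m ->
  (hessian (objective mu p) m)^T = hessian (objective mu p) m.
Proof.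
move=> mint; apply: hessian_sym => [|j].
  apply: filterS (near_interior mint) => y; exact: objective_differentiable.
exact: derive_objective_differentiable.
Qed.

(* Differentiating the first-order condition [grad E (mt t) = - t] at [t = 0]. *)
Lemma jacobian_mul_hessian (mt : 'rV[R]_n -> 'rV[R]_n) m :
  (mean_space mu)° m -> mt 0 = m -> differentiable mt 0 ->
  (\forall t \near (0 : 'rV[R]_n),
    grad (objective mu (perturb mu p t)) (mt t) = 0) ->
  jacobian mt 0 *m hessian (objective mu p) m = - 1%:M.
Proof.
move=> mint m0 dmt hmt.
have cmt := differentiable_continuous dmt.
(* The gradient formulas hold only at interior means; continuity of [mt] keeps it there for small
   [t]. *)
have int0 : \forall t \near (0 : 'rV[R]_n), (mean_space mu)° (mt t).
  by apply: cmt; rewrite m0; exact: near_interior.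
have E j : \forall t \near (0 : 'rV[R]_n), - (t : 'rV[R]_n) 0 j =
    ((fun y => 'D_(delta_mx 0 j) (objective mu p) y) \o mt) t.
  apply: filterS2 hmt int0 => t g tint.
  have := congr1 (fun a : 'rV[R]_n => a 0 j) g.
  rewrite grad_objective_perturb// [in LHS]mxE [grad _ _ _ _]mxE [in RHS]mxE.
  by move/eqP; rewrite addr_eq0 => /eqP /= ->.
apply/matrixP => k j.
have dP : differentiable (fun y => 'D_(delta_mx 0 j) (objective mu p) y) (mt 0).
  by rewrite m0; exact: derive_objective_differentiable.
have := near_eq_derive (delta_mx 0 k) (E j).
rewrite derive_comp_rV// deriveEjacobian// deriveN; last first.
  by apply: diff_derivable; exact: differentiable_coord.
rewrite deriveE; last exact: differentiable_coord.
rewrite -deriveE; last exact: differentiable_coord.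
rewrite (derive_coord_rV (N := id))// derive_id m0 => E'.
rewrite mxE [RHS]mxE [in RHS]mxE.
rewrite [delta_mx _ _ _ _]mxE eqxx/= in E'.
rewrite eq_sym E'; apply: eq_bigr => i _.
rewrite mulrC; congr (_ * _); last by rewrite -rowE [RHS]mxE.
by rewrite [LHS]mxE [RHS]mxE.
Qed.

End LogLikelihood.
End ObjectiveCalculus.

Theorem mainTheorem1 (R : realType) (n : nat)
    (mu : {measure set (sample R n) -> \bar R}) (p : sample R n -> R)
    (mstar : 'rV[R]_n) (mt : 'rV[R]_n -> 'rV[R]_n)
    (hreg : regular_family mu) (hmin : minimal_family mu)
    (hp : is_density mu p) (hlogp : log_integrable mu p)
    (hint : (mean_space mu)° mstar)
    (hopt : local_max (objective mu p) mstar \/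
            local_min (objective mu p) mstar)
    (hhess : hessian (objective mu p) mstar \in unitmx)
    (hpt : \forall t \near (0 : 'rV[R]_n), is_density mu (perturb mu p t))
    (hmt0 : mt 0 = mstar)
    (hmt : \forall t \near (0 : 'rV[R]_n),
        [/\ mean_space mu (mt t),
            grad (objective mu (perturb mu p t)) (mt t) = 0
          & differentiable mt t]) :
  let V := cov mu (nat_of_mean mu mstar) in
  let H := hessian (exp_loglik mu p) mstar in
  (* [jacobian] acts on row vectors; its transpose has entries d mt_i / d t_j *)
  let Sigma := (jacobian mt 0)^T in
  [/\ [/\ V \in unitmx, H - invmx V \in unitmx & 1%:M - V *m H \in unitmx],
      [/\ Sigma = - invmx (hessian (objective mu p) mstar),
          Sigma = - invmx (H - invmx V)
        & Sigma = invmx (1%:M - V *m H) *m V],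
      Sigma^T = Sigma
    & local_max (objective mu p) mstar -> posdef Sigma].
Proof.
move=> V H Sigma; case: hp => mp p0 p1.
(* Against a null measure [p] could not integrate to one. *)
have mu_neq0 : ~ {ae mu, forall x, False}.
  move=> mu0; have : (\int[mu]_x (p x)%:E = \int[mu]_x (cst 0 x))%E.
    apply: ae_eq_integral => //; first exact/measurable_EFinP.
    by apply: filterS mu0.
  by rewrite p1 integral0 => /eqP; rewrite onee_eq0.
have [hN _] := nat_of_meanP (nbhs_singleton hint).
have uV : V \in unitmx by exact/posdef_unitmx/cov_posdef.
have hE := hessian_objective hreg mu_neq0 hmin mp hlogp hint.
rewrite -/V -/H in hE.
have sE := hessian_objective_sym hreg mu_neq0 hmin mp hlogp hint.
have uHV : H - invmx V \in unitmx by rewrite -hE.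
have [_ foc0 dmt] := nbhs_singleton hmt.
have foc : \forall t \near (0 : 'rV[R]_n),
    grad (objective mu (perturb mu p t)) (mt t) = 0.
  by apply: filterS hmt => t [].
have JH := jacobian_mul_hessian hreg mu_neq0 hmin mp hlogp hint hmt0 dmt foc.
have JE : jacobian mt 0 = - invmx (hessian (objective mu p) mstar).
  by rewrite -[LHS](mulmxK hhess) JH mulNmx mul1mx.
(* Symmetry of the Hessian makes the transpose harmless. *)
have SE : Sigma = - invmx (hessian (objective mu p) mstar).
  by rewrite /Sigma JE linearN/= trmx_inv sE.
(* This factorization gives both the invertibility of [1%:M - V *m H] and the third formula. *)
have VHE : 1%:M - V *m H = - (V *m (H - invmx V)).
  by rewrite mulmxBr mulmxV// opprB.
have uVH : 1%:M - V *m H \in unitmx.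
  by rewrite VHE -scaleN1r unitmxZ ?unitrN1// unitmx_mul uV.
have S2 : Sigma = - invmx (H - invmx V) by rewrite SE hE.
split=> //.
- split=> //; rewrite -[LHS](mulKmx uVH) {2}VHE S2; congr (_ *m _).
  by rewrite mulmxN mulNmx opprK -mulmxA mulmxV// mulmx1.
- by rewrite SE linearN/= trmx_inv sE.
(* A tilt by [0] leaves the gradient unchanged, so the first-order condition at [t = 0] makes
   [mstar] stationary for the original objective. *)
move=> hmax; have g0 : grad (objective mu p) mstar = 0.
  have := grad_objective_perturb hreg mu_neq0 hmin mp hlogp 0 hint.
  by rewrite addr0 => <-; rewrite -[X in grad _ X]hmt0.
have sN : (- hessian (objective mu p) mstar)^T = - hessian (objective mu p) mstar.
  by rewrite linearN/= sE.
have uN : - hessian (objective mu p) mstar \in unitmx.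
  by rewrite -scaleN1r unitmxZ ?unitrN1.
(* The second-order condition gives only semidefiniteness; invertibility of the Hessian makes it
   strict. *)
have pN : posdef (- hessian (objective mu p) mstar).
  apply: psd_unit_posdef => // u; rewrite mulmxN innerNl oppr_ge0 innerE.
  apply: hessian_nsd => // [|j].
    apply: filterS (near_interior hint) => y; exact: objective_differentiable.
  exact: derive_objective_differentiable.
have -> : Sigma = invmx (- hessian (objective mu p) mstar).
  by rewrite -[LHS](mulKmx uN) SE mulmxN mulNmx opprK mulmxV// mulmx1.
exact: posdef_invmx.
Qed.
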